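(* If the maximum degree $\Delta$ of the input graph $G$ satisfies $\Delta=O(n^{1/3})$, then there is a deterministic distributed algorithm in the congested clique model that computes a maximal independent set of $G$ within $O(\log \Delta)$ rounds, and there is a deterministic distributed algorithm in the congested clique model that computes a proper $(\Delta+1)$-coloring of $G$ within $O(\log \Delta)$ rounds.
   Context: The input is an undirected graph $G=(V,E)$ with $n=|V|$ nodes, each node knowing its own unique $O(\log n)$-bit identifier and its incident edges. In the congested clique model, computation proceeds in synchronous rounds; in each round every pair of the $n$ nodes may exchange a message of $O(\log n)$ bits (communication is all-to-all, independent of $G$), and local computation is free. A maximal independent set is a set $I\subseteq V$ with no two nodes of $I$ adjacent such that every node outside $I$ has a neighbor in $I$. A proper $(\Delta+1)$-coloring assigns each node a color in $\{1,\dots,\Delta+1\}$ so that adjacent nodes receive different colors. At the end each node must know its own output. *)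

(* Defs.v *)
(* A formal model of deterministic algorithms in the
   congested clique (KT1-style: nodes address each other by identifier). *)
From mathcomp Require Import all_boot.
Set Implicit Arguments. Unset Strict Implicit.
Set Warnings "-notation-overridden". Unset Printing Implicit Defensive.

(* A deterministic congested-clique algorithm.  Local computation is free,
   so the local state space and transition functions are arbitrary.
   - init n myid nbr : initial state of a node knowing n, its own identifier
     and (the identifiers of) its incident edges (nbr x = true iff the node
     with identifier x is a neighbour);
   - msg s x : message (a natural number) sent to the node with identifier x;
   - upd s rcv : new state after receiving rcv x = Some m from the node with
     identifier x (None if there is no other node with identifier x);
   - out s : None = no output yet, Some o = (irrevocable) output o. *)
Record Alg : Type := MkAlg {
  St : Type;
  init : nat -> nat -> (nat -> bool) -> St;
  msg : St -> nat -> nat;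
  upd : St -> (nat -> option nat) -> St;
  out : St -> option nat
}.

Definition nbr_ids n (adj : rel 'I_n) (id : 'I_n -> nat) (v : 'I_n) : nat -> bool :=
  fun x => [exists u, adj v u && (id u == x)].

Fixpoint run (A : Alg) n (adj : rel 'I_n) (id : 'I_n -> nat) (t : nat)
  : 'I_n -> St A :=
  match t with
  | 0 => fun v => @init A n (id v) (nbr_ids adj id v)
  | t'.+1 => fun v =>
      @upd A (run A adj id t' v)
        (fun x => match [pick u | (u != v) && (id u == x)] with
                  | Some u => Some (@msg A (run A adj id t' u) (id v))
                  | None => None
                  end)
  end.

Definition bits (n : nat) : nat := (trunc_log 2 n).+1.

Definition simple_graph n (adj : rel 'I_n) : Prop :=
  symmetric adj /\ irreflexive adj.

Definition max_degree n (adj : rel 'I_n) : nat :=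
  \max_(v : 'I_n) #|[set u | adj v u]|.

Definition valid_ids n (id : 'I_n -> nat) (kid : nat) : Prop :=
  injective id /\ forall v, id v < 2 ^ (kid * bits n).

Definition computes_within (A : Alg) n (adj : rel 'I_n) (id : 'I_n -> nat)
    (B T : nat) (P : ('I_n -> nat) -> Prop) : Prop :=
  (forall t (v u : 'I_n), t < T -> u != v ->
      @msg A (run A adj id t v) (id u) < 2 ^ (B * bits n)) /\
  (forall t v o, @out A (run A adj id t v) = Some o ->
      @out A (run A adj id t.+1 v) = Some o) /\
  exists f : 'I_n -> nat,
    (forall v, @out A (run A adj id T v) = Some (f v)) /\ P f.

(* output 1 = in the set, 0 = not in the set *)
Definition is_MIS n (adj : rel 'I_n) (f : 'I_n -> nat) : Prop :=
  (forall v, f v <= 1) /\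
  (forall u v, adj u v -> ~ (f u = 1 /\ f v = 1)) /\
  (forall v, f v = 0 -> exists u, adj v u /\ f u = 1).

Definition is_Delta1_coloring n (adj : rel 'I_n) (f : 'I_n -> nat) : Prop :=
  (forall v, 1 <= f v <= (max_degree adj).+1) /\
  (forall u v, adj u v -> f u <> f v).

(* Main.v *)
Require Import Defs.
From mathcomp Require Import all_boot ssralg finalg finfield zify ring.

Set Implicit Arguments. Unset Strict Implicit. Unset Printing Implicit Defensive.

(** Both algorithms derandomize a one-phase procedure whose randomness is a
    pairwise independent hash [a * x + b] over a field with [Theta(n)] elements.
    As [D * D <= n] (for large [D]), every node learns its 2-hop neighbourhood
    in O(1) rounds; with the current statuses broadcast in every phase it can
    then evaluate its own gain for each seed [(a, b)].  Each node is in charge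
    of two field elements, so the sums of gains are computed in O(1) rounds, and
    the method of conditional expectations fixes first [a], then [b].
    For the independent set the phase is Luby's (node [u] is marked with
    probability [1 / (8 d(u))]) and the gain counts deleted edges; for the
    coloring every node tries a color of its palette with probability 1/2, and
    the gain counts newly colored nodes.  A phase removes at least 1/192 of the
    potential, so after O(log D) phases the remaining instance has O(n) edges,
    is made known to all nodes in O(1) rounds, and is solved locally. *)


(** * Node programs *)

Section Programs.
Variable n : nat.

(** Nodes also receive their own message. Received vectors are finite functions, so that pointwise
    equal ones are equal. *)
Inductive prog : Type :=
| Ret of nat
| Exch of ('I_n -> nat) & ({ffun 'I_n -> nat} -> prog).

(* The family [P] of node programs, run synchronously, halts everywhere after
   exactly [T] rounds, sends only messages smaller than [W], and the vector of
   returned values satisfies [Q]. *)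
Fixpoint Runs (W T : nat) (P : 'I_n -> prog) (Q : ('I_n -> nat) -> Prop) : Prop :=
  match T with
  | 0 => exists f, (forall v, P v = Ret (f v)) /\ Q f
  | T'.+1 => exists s k, [/\ forall v, P v = Exch (s v) (k v),
                            forall v u, s v u < W
                          & Runs W T' (fun v => k v [ffun u => s u v]) Q]
  end.

Variable W : nat.

Lemma Runs_ext T P P' Q : P =1 P' -> Runs W T P Q -> Runs W T P' Q.
Proof.
case: T => [|T] /= eqP.
  by case=> f [Pf Qf]; exists f; split=> // v; rewrite -eqP.
by case=> s [k [Pk sW R]]; exists s, k; split=> // v; rewrite -eqP.
Qed.

Lemma Runs_exch T s k Q : (forall v u, s v u < W) ->
  Runs W T (fun v => k v [ffun u => s u v]) Q ->
  Runs W T.+1 (fun v => Exch (s v) (k v)) Q.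
Proof. by move=> sW R; exists s, k. Qed.

Definition bcast (w : nat) k := Exch (fun _ => w) k.

Lemma Runs_bcast T w k Q : (forall v, w v < W) ->
  Runs W T (fun v => k v [ffun u => w u]) Q ->
  Runs W T.+1 (fun v => bcast (w v) (k v)) Q.
Proof. by move=> wW R; apply: Runs_exch. Qed.

(** Indices are sent from [c - 1] down to 0, so that [rcons] leaves value number [i] at position
    [i]. *)
Fixpoint bcasts (c : nat) (w : nat -> nat) (k : seq {ffun 'I_n -> nat} -> prog) :=
  if c is c'.+1 then bcast (w c') (fun r => bcasts c' w (fun rs => k (rcons rs r)))
  else k [::].

Lemma Runs_bcasts c T w k Q : (forall v i, i < c -> w v i < W) ->
  Runs W T (fun v => k v (mkseq (fun i => [ffun u => w u i]) c)) Q ->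
  Runs W (c + T) (fun v => bcasts c (w v) (k v)) Q.
Proof.
elim: c k => [|c IH] k wW R //; apply: Runs_bcast => [v|]; first exact: wW.
apply: (IH (fun v rs => k v (rcons rs _))) => [v i ic|]; first exact/wW/ltnW.
by apply: Runs_ext R => v; rewrite mkseqS.
Qed.

Definition sumvec (y : 'I_n -> nat) (k : {ffun 'I_n -> nat} -> prog) :=
  Exch y (fun r => bcast (\sum_u r u) k).

Lemma Runs_sumvec T y k Q :
  (forall p, \sum_v y v p < W) ->
  Runs W T (fun v => k v [ffun p => \sum_u y u p]) Q ->
  Runs W T.+2 (fun v => sumvec (y v) (k v)) Q.
Proof.
move=> yW R; apply: Runs_exch => [v u|].
  by apply: leq_ltn_trans (yW u); rewrite (bigD1 v) //= leq_addr.
apply: (Runs_bcast (w := fun p => \sum_u [ffun u0 => y u0 p] u)) => [p|].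
  by under eq_bigr do rewrite ffunE.
apply: Runs_ext R => v; congr (k v _); apply/ffunP => p; rewrite !ffunE.
by under [RHS]eq_bigr do rewrite ffunE.
Qed.

Definition get (r : {ffun 'I_n -> nat}) (i : nat) : nat :=
  if insub i is Some j then r j else 0.

Lemma get_ord r (j : 'I_n) : get r j = r j.
Proof. by rewrite /get valK. Qed.

(* Node [p] adds up the values of the options number [p] and [n + p]. *)
Definition sumall (A : finType) (y : A -> nat) (k : {ffun A -> nat} -> prog) :=
  let opt c := fun p : 'I_n => nth 0 (map y (enum A)) (c * n + p) in
  sumvec (opt 0) (fun r0 => sumvec (opt 1) (fun r1 =>
    k [ffun a => if enum_rank a < n then get r0 (enum_rank a)
                 else get r1 (enum_rank a - n)])).

Lemma Runs_sumall (A : finType) T (y : 'I_n -> A -> nat) k Q :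
  0 < W -> #|A| <= n.*2 ->
  (forall a, \sum_v y v a < W) ->
  Runs W T (fun v => k v [ffun a => \sum_u y u a]) Q ->
  Runs W (T + 4) (fun v => sumall (y v) (k v)) Q.
Proof.
move=> W0 An yW R; rewrite addn4.
have E j : \sum_v nth 0 (map (y v) (enum A)) j < W.
  case: (ltnP j #|A|) => jA.
    have a := enum_val (Ordinal jA).
    under eq_bigr => v _ do rewrite (nth_map a) -?cardE //.
    exact: yW.
  by rewrite big1 // => v _; rewrite nth_default // size_map -cardE.
apply: Runs_sumvec => [p|]; first exact: E.
apply: Runs_sumvec => [p|]; first exact: E.
apply: Runs_ext R => v; congr (k v _); apply/ffunP => a; rewrite !ffunE.
have nthE u : nth 0 (map (y u) (enum A)) (enum_rank a) = y u a.
  by rewrite (nth_map a) -?cardE // nth_enum_rank.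
case: ltnP => ra; rewrite /get.
  rewrite insubT ffunE /=; apply: eq_bigr => u _; by rewrite mul0n nthE.
have lt : enum_rank a - n < n.
  have := leq_trans (ltn_ord (enum_rank a)) An; lia.
rewrite insubT ffunE; apply: eq_bigr => u _.
by rewrite mul1n /= subnKC // nthE.
Qed.

(** Conditional expectations: the sum over [b] is, up to the factor [#|A|], the mean gain given [a].
    All nodes see the same totals and hence pick the same pair. *)
Definition select (A : finType) (a0 : A) (y : A -> A -> nat) (k : A -> A -> prog) :=
  sumall (fun a => \sum_b y a b) (fun ta =>
    let a := [arg max_(a > a0) ta a] in
    sumall (y a) (fun tb => k a [arg max_(b > a0) tb b])).

Lemma sum_le_arg_max (A : finType) (a0 : A) (t : A -> nat) :
  \sum_a t a <= #|A| * t [arg max_(a > a0) t a].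
Proof.
case: arg_maxnP => // a _ max_a.
by rewrite -sum_nat_const; apply: leq_sum => b _; apply: max_a.
Qed.

(** The chosen [a] is at least as good as the mean over all [a], and the chosen [b] at least as good
    as the mean over [b] for that [a]; the two averages multiply. *)
Lemma Runs_select (A : finType) (a0 : A) T (y : 'I_n -> A -> A -> nat) k Q :
  0 < W -> #|A| <= n.*2 ->
  (forall a, \sum_v \sum_b y v a b < W) ->
  (forall a b, \sum_a' \sum_b' \sum_v y v a' b' <= #|A| * #|A| * \sum_v y v a b ->
     Runs W T (fun v => k v a b) Q) ->
  Runs W (T + 8) (fun v => select a0 (y v) (k v)) Q.
Proof.
move=> W0 An yW R; rewrite -[8]/(4 + 4) addnA.
have yW' a b : \sum_v y v a b < W.
  apply: leq_ltn_trans (yW a); apply: leq_sum => v _.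
  by rewrite (bigD1 b) //= leq_addr.
apply: Runs_sumall => //; apply: Runs_sumall => //.
set ta := [ffun _ => _]; set a := [arg max_(_ > _) _].
set tb := [ffun _ => _]; set b := [arg max_(_ > _) _].
apply: R; rewrite -mulnA.
have le_a : \sum_a' ta a' <= #|A| * ta a by exact: sum_le_arg_max.
have le_b : \sum_b' tb b' <= #|A| * tb b by exact: sum_le_arg_max.
have -> : \sum_v y v a b = tb b by rewrite ffunE.
have Eta a' : ta a' = \sum_b' \sum_v y v a' b' by rewrite ffunE exchange_big.
have -> : \sum_a' \sum_b' \sum_v y v a' b' = \sum_a' ta a'.
  by apply: eq_bigr => a' _; rewrite Eta.
apply: leq_trans le_a _; rewrite leq_mul2l; apply/orP; right.
apply: leq_trans le_b; rewrite Eta; apply: leq_sum => b' _; by rewrite ffunE.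
Qed.

(* Entry [j] of the concatenation of all lists is routed through the node
   [j %% n]; as each list has at most [n] entries, a node never routes two of
   its own entries through the same intermediate. *)
Definition publish (c : nat) (v : 'I_n) (L : seq nat)
    (k : {ffun 'I_n -> seq nat} -> prog) :=
  bcast (size L) (fun sz =>
  let sh := [seq sz u | u <- enum 'I_n] in
  Exch (fun p => head 0 [seq nth 0 L (reshape_offset sh j) |
                           j <- iota 0 (sumn sh) &
                           (reshape_index sh j == v) && (j %% n == p)])
  (fun r =>
  bcasts c (fun i => get r (reshape_index sh (i * n + v)))
  (fun rs =>
  let X := mkseq (fun j => get (nth [ffun=> 0] rs (j %/ n)) (j %% n)) (sumn sh) in
  k [ffun u : 'I_n => nth [::] (reshape sh X) u]))).

Lemma nth_map_enum_ord (T : Type) (x0 : T) (f : 'I_n -> T) (u : 'I_n) :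
  nth x0 [seq f v | v <- enum 'I_n] u = f u.
Proof. by rewrite (nth_map u) ?size_enum_ord // nth_ord_enum. Qed.

Lemma Runs_publish c T (L : 'I_n -> seq nat) k Q :
  (forall v, size (L v) <= n) -> \sum_v size (L v) <= c * n ->
  n < W -> (forall v x, x \in L v -> x < W) ->
  Runs W T (fun v => k v [ffun u => L u]) Q ->
  Runs W (c + T).+2 (fun v => publish c v (L v) (k v)) Q.
Proof.
move=> Ln Lc nW LW R.
have W0 : 0 < W by exact: leq_ltn_trans nW.
have LW0 v i : nth 0 (L v) i < W.
  case: (ltnP i (size (L v))) => iL; last by rewrite nth_default.
  by apply: (LW v); rewrite mem_nth.
apply: Runs_bcast => [v|]; first exact: leq_ltn_trans (Ln v) nW.
set sz := [ffun _ => _]; set sh := [seq sz u | u <- enum 'I_n].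
pose ss := [seq L u | u <- enum 'I_n].
have shE : sh = shape ss.
  by rewrite /sh /ss /shape -map_comp; apply: eq_map => u; rewrite ffunE.
have szsh : size sh = n by rewrite size_map size_enum_ord.
have nthsh (u : 'I_n) : nth 0 sh u = size (L u) by rewrite nth_map_enum_ord ffunE.
have sumsh : sumn sh <= c * n.
  rewrite sumnE big_map big_enum /=.
  by under eq_bigr do rewrite ffunE.
pose send v (p : 'I_n) := head 0 [seq nth 0 (L v) (reshape_offset sh j) |
  j <- iota 0 (sumn sh) & (reshape_index sh j == v) && (j %% n == p)].
have sendW v p : send v p < W.
  by rewrite /send; case: [seq j <- _ | _] => [|j s] //=.
have sendE j (u p : 'I_n) : j < sumn sh -> reshape_index sh j = u -> j %% n = p ->
    send u p = nth 0 (flatten ss) j.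
  move=> jsh ju jp; rewrite /send nth_flatten -shE ju nth_map_enum_ord.
  have : j \in [seq j0 <- iota 0 (sumn sh) |
                 (reshape_index sh j0 == u) && (j0 %% n == p)].
    by rewrite mem_filter ju jp !eqxx mem_iota.
  case Es: [seq _ <- _ | _] => [|j' s] //= _.
  have : j' \in [seq j0 <- iota 0 (sumn sh) |
                 (reshape_index sh j0 == u) && (j0 %% n == p)] by rewrite Es mem_head.
  rewrite mem_filter mem_iota add0n /= => /andP[/andP[/eqP ju' /eqP jp'] jsh'].
  (* The filtered list has only one element: two entries of one list lie less than [n] apart, so
     equal residues modulo [n] make them equal. *)
  suff -> : j' = j by [].
  have := reshape_offsetP jsh; have := reshape_offsetP jsh'.
  have := reshape_indexK sh j; have := reshape_indexK sh j'.
  rewrite ju ju' nthsh /flatten_index; set x := sumn _.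
  move=> Ej' Ej lo lo'; have le_u := Ln u.
  have := divn_eq j n; have := divn_eq j' n; rewrite jp jp'.
  set a := j %/ n; set a' := j' %/ n => e1 e2.
  have [aa|aa|aa] := ltngtP a a'; last by rewrite e1 e2 aa.
    have := leq_mul aa (leqnn n); lia.
  have := leq_mul aa (leqnn n); lia.
apply: Runs_exch => [v u|]; first exact: sendW.
apply: Runs_bcasts => [v i _|].
  by rewrite /get; case: insubP => // u _ _; rewrite ffunE; apply: sendW.
apply: Runs_ext R => v; congr (k v _); apply/ffunP => u; rewrite !ffunE.
set X := mkseq _ _.
(* Entry [j] of the concatenation reaches everyone as value number [j %/ n] broadcast by node
   [j %% n]. *)
have -> : X = flatten ss.
  apply: (@eq_from_nth _ 0); rewrite size_mkseq shE -?size_flatten // => j jlt.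
  have jsh : j < sumn sh by rewrite shE -size_flatten.
  have n0 : 0 < n by case: (posnP n) u => [-> []|].
  have jc : j %/ n < c by rewrite ltn_divLR //; apply: leq_trans sumsh.
  rewrite nth_mkseq -?size_flatten // nth_mkseq //.
  have ltm : j %% n < n by rewrite ltn_mod.
  rewrite -[j %% n]/(val (Ordinal ltm)) get_ord ffunE /= -divn_eq.
  have lti : reshape_index sh j < n by rewrite -szsh reshape_indexP.
  rewrite -[reshape_index sh j]/(val (Ordinal lti)) get_ord ffunE.
  by apply: (sendE j (Ordinal lti) (Ordinal ltm)).
by rewrite shE flattenK nth_map_enum_ord.
Qed.

(** * Gathering the 2-hop neighbourhood *)

Definition graph := {ffun 'I_n -> {set 'I_n}}.

Definition view (G : graph) (v : 'I_n) : graph :=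
  [ffun u => if (u == v) || (u \in G v) then G u else set0].

Lemma viewE (G : graph) (u v : 'I_n) : u \in v |: G v -> view G v u = G u.
Proof. by rewrite !inE ffunE => ->. Qed.

Lemma view_self (G : graph) v : view G v v = G v.
Proof. by rewrite viewE // setU11. Qed.

(** The default [n] is the number of no node and encodes a missing neighbour. *)
Definition nbr_at (N : {set 'I_n}) (i : nat) : nat := nth n (map val (enum N)) i.

(* With at most [D] neighbours per node and [D * D <= n], the node [p] relays
   to [v] the [(p %% D)]-th neighbour of the [(p %/ D)]-th neighbour of [v]:
   [v] tells [p] who that neighbour is, and every [u] tells [p] its own
   [(p %% D)]-th neighbour. *)
Definition gather (D : nat) (v : 'I_n) (N : {set 'I_n}) (k : graph -> prog) :=
  Exch (fun p => nbr_at N (p %/ D)) (fun want =>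
  Exch (fun p => nbr_at N (p %% D)) (fun item =>
  Exch (fun u => if insub (want u) is Some w then item w else n) (fun r =>
  k [ffun u => if u == v then N else
       [set w : 'I_n | [exists p : 'I_n, (nbr_at N (p %/ D) == u) && (r p == w)]]]))).

Lemma nbr_at_le N i : nbr_at N i <= n.
Proof.
rewrite /nbr_at; case: (ltnP i (size (map val (enum N)))) => iN; last by rewrite nth_default.
by have /mapP[u _ ->] := mem_nth n iN; apply/ltnW/ltn_ord.
Qed.

Lemma nbr_atP N i (u : 'I_n) : nbr_at N i = u -> u \in N.
Proof.
rewrite /nbr_at; case: (ltnP i (size (map val (enum N)))) => iN.
  have := mem_nth n iN => /[swap] ->; rewrite mem_map ?mem_enum //; exact: val_inj.
by rewrite nth_default // => En; have := ltn_ord u; rewrite -En ltnn.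
Qed.

Lemma nbr_at_index (N : {set 'I_n}) (u : 'I_n) : u \in N -> nbr_at N (index u (enum N)) = u.
Proof.
by move=> uN; rewrite /nbr_at (nth_map u) ?nth_index ?index_mem ?mem_enum.
Qed.

Lemma Runs_gather D T (G : graph) k Q : n < W ->
  (forall v, #|G v| <= D) -> D * D <= n ->
  Runs W T (fun v => k v (view G v)) Q ->
  Runs W T.+3 (fun v => gather D v (G v) (k v)) Q.
Proof.
move=> nW GD Dn R.
have atW N i : nbr_at N i < W by exact: leq_ltn_trans (nbr_at_le N i) nW.
apply: Runs_exch => // ; apply: Runs_exch => //; apply: Runs_exch => [v u|].
  by case: insubP => // w _ _; rewrite ffunE.
apply: Runs_ext R => v; congr (k v _); apply/ffunP => u; rewrite !ffunE.
case: eqP => [-> //|_] /=; apply/setP => w; rewrite [RHS]inE.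
apply/idP/existsP => [|[p]].
  case: ifP => [uv wu|]; last by rewrite inE.
  have iu : index u (enum (G v)) < D.
    by apply: leq_trans (GD v); rewrite cardE index_mem mem_enum.
  have iw : index w (enum (G u)) < D.
    by apply: leq_trans (GD u); rewrite cardE index_mem mem_enum.
  (* A relay for this pair of positions exists because [D * D <= n]. *)
  have lt_p : index u (enum (G v)) * D + index w (enum (G u)) < n.
    apply: leq_trans Dn; have := leq_mul iu (leqnn D); lia.
  have D0 : 0 < D by exact: leq_ltn_trans iu.
  have pD : Ordinal lt_p %/ D = index u (enum (G v)).
    by rewrite /= divnMDl // divn_small // addn0.
  have pM : Ordinal lt_p %% D = index w (enum (G u)).
    by rewrite /= modnMDl modn_small.
  exists (Ordinal lt_p); rewrite !ffunE pD nbr_at_index // eqxx /=.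
  by rewrite valK ffunE pM nbr_at_index.
rewrite !ffunE => /andP[/eqP Eu]; rewrite Eu valK ffunE => /eqP Ew.
by rewrite (nbr_atP Eu) (nbr_atP Ew).
Qed.

End Programs.


(** * Pairwise independent hashing *)

(** Values are ranks of field elements, so an event of prescribed probability is an interval of
    naturals. *)
Definition hash (F : finFieldType) (n : nat) (a b : F) (u : 'I_n) : nat :=
  enum_rank (a * nth 0 (enum F) u + b)%R.

Section Hash.
Variables (F : finFieldType) (n : nat).
Hypothesis nF : n <= #|F|.

Lemma sum_enum_rank (f : nat -> nat) :
  \sum_(y : F) f (enum_rank y) = \sum_(i < #|F|) f i.
Proof.
by rewrite [RHS](reindex (@enum_rank F)) //; apply/onW_bij/enum_rank_bij.
Qed.

(** Uniformity: for fixed [a] the hash is a translation in [b], hence a bijection of the field. *)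
Lemma sum_hash (f : nat -> nat) (u : 'I_n) :
  \sum_(a : F) \sum_(b : F) f (hash a b u) = #|F| * \sum_(i < #|F|) f i.
Proof.
rewrite -sum_nat_const; apply: eq_bigr => a _; rewrite -sum_enum_rank.
by rewrite [RHS](reindex_inj (GRing.addrI (a * nth 0 (enum F) u)))%R.
Qed.

(** Pairwise independence: for distinct points [x] and [y], the map from [(a, b)] to
    [(a * x + b, a * y + b)] is a bijection. *)
Lemma sum_hash2 (f g : nat -> nat) (u w : 'I_n) : u != w ->
  \sum_(a : F) \sum_(b : F) f (hash a b u) * g (hash a b w) =
  (\sum_(i < #|F|) f i) * (\sum_(i < #|F|) g i).
Proof.
move=> uw; rewrite -!sum_enum_rank big_distrlr /= !pair_big /=.
pose x : F := nth 0%R (enum F) u; pose y : F := nth 0%R (enum F) w.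
have xy : (x - y != 0)%R.
  rewrite GRing.subr_eq0 nth_uniq ?enum_uniq -?cardE //; exact: leq_trans nF.
pose phi (s : F * F) := (s.1 * x + s.2, s.1 * y + s.2)%R.
have phi_inj : injective phi.
  case=> a b [a' b'] [Ex Ey].
  have Ea : (a * (x - y) = a' * (x - y))%R.
    have -> : (a * (x - y) = (a * x + b) - (a * y + b))%R by ring.
    by rewrite [X in (X - _)%R]Ex [X in (_ - X)%R]Ey; ring.
  have {}Ea := GRing.mulIf xy Ea; rewrite Ea in Ex *.
  by rewrite (GRing.addrI _ Ex).
by rewrite [RHS](reindex_inj phi_inj).
Qed.

End Hash.

(** Its size [2 ^ bits n] exceeds [n], so nodes embed into it, and is at most [n.*2] for positive
    [n], so two field elements per node suffice. *)
Definition seed_field (n : nat) : finFieldType :=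
  s2val (pPrimePowerField (isT : prime 2) (ltn0Sn (trunc_log 2 n))).

Lemma card_seed_field n : #|seed_field n| = 2 ^ bits n.
Proof. exact: (s2valP' (pPrimePowerField _ _)). Qed.

Lemma ltn_card_seed_field n : n < #|seed_field n|.
Proof. by rewrite card_seed_field trunc_log_ltn. Qed.

Lemma card_seed_field_le n : 0 < n -> #|seed_field n| <= n.*2.
Proof.
by move=> n0; rewrite card_seed_field expnS mul2n leq_double trunc_logP.
Qed.

(** The largest message sums gains of at most [n.*2] over all nodes and all [b]. With [x] the field
    size, [n < x] and [2 <= x], the left side is at most [x ^ 4 + x ^ 2 < x ^ 5]. *)
Lemma seed_message_bound n :
  n.*2 * n * #|seed_field n| + n.*2 < 2 ^ (5 * bits n).
Proof.
rewrite [5 * _]mulnC expnM -card_seed_field.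
have F2 : 1 < #|seed_field n| by rewrite card_seed_field (ltn_exp2l 0).
move: #|_| (ltn_card_seed_field n) F2 => x nx x2; rewrite !expnS expn0 muln1.
have h1 : n.*2 <= x * x by nia.
have h2 : n.*2 * n <= x * x * x by apply: leq_mul => //; lia.
have h3 := leq_mul h2 (leqnn x).
have h4 : x * x * x * x + x * x < x * x * x * x * 2.
  have : 1 < x * x by nia.
  rewrite -[_ * x * x]mulnA; move: (x * x) => y y1.
  by rewrite muln2 -addnn ltn_add2l ltn_Pmull // ltnW.
apply: leq_ltn_trans (leq_add h3 h1) _; apply: (leq_trans h4).
by rewrite !mulnA leq_mul2l x2 orbT.
Qed.

(** * Derandomized phases *)

Section Phases.
Variables (n : nat) (F : finType) (a0 : F).
Local Notation vec := {ffun 'I_n -> nat}.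
Variable aux : graph n -> vec -> 'I_n -> nat.
Variables gain new : graph n -> vec -> vec -> F -> F -> 'I_n -> nat.

(** The status vector [s] is common knowledge, while [g] is the local view. A phase takes ten
    rounds: one for [aux], eight for [select], one for the new statuses. *)
Fixpoint phases (m : nat) (v : 'I_n) (g : graph n) (s : vec) (k : vec -> prog n) :=
  if m is m'.+1 then
    bcast (aux g s v) (fun d =>
    select a0 (fun a b => gain g s d a b v) (fun a b =>
    bcast (new g s d a b v) (fun s' => phases m' v g s' k)))
  else k s.

Variables (W c : nat) (G : graph n) (Inv : vec -> Prop) (Phi : vec -> nat).
Let auxv s : vec := [ffun v => aux G s v].
Let newv s a b : vec := [ffun v => new G s (auxv s) a b v].

Hypothesis HW : n.*2 * n * #|F| + n.*2 < W.
Hypothesis Fn : #|F| <= n.*2.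
Hypothesis aux_view : forall s v, aux (view G v) s v = aux G s v.
Hypothesis gain_view : forall s d a b v,
  gain (view G v) s d a b v = gain G s d a b v.
Hypothesis new_view : forall s d a b v,
  new (view G v) s d a b v = new G s d a b v.
Hypothesis aux_le : forall s v, aux G s v <= n.*2.
Hypothesis gain_le : forall s d a b v, gain G s d a b v <= n.*2.
Hypothesis new_le : forall s a b v, Inv s -> newv s a b v <= n.*2.
Hypothesis new_Inv : forall s a b, Inv s -> Inv (newv s a b).
Hypothesis Phi_gain : forall s a b, Inv s ->
  Phi (newv s a b) + \sum_v gain G s (auxv s) a b v <= Phi s.
Hypothesis gain_avg : forall s, Inv s ->
  #|F| * #|F| * Phi s <= c.+1 * \sum_a \sum_b \sum_v gain G s (auxv s) a b v.

(** The selected seed gains at least the average, hence at least [Phi s / c.+1], and each phase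
    multiplies the potential by at most [c / c.+1]. *)
Lemma Runs_phases m T s k Q : Inv s ->
  (forall s', Inv s' -> c.+1 ^ m * Phi s' <= c ^ m * Phi s ->
     Runs W T (fun v => k v s') Q) ->
  Runs W (m * 10 + T) (fun v => phases m v (view G v) s (k v)) Q.
Proof.
have ltW x : x <= n.*2 -> x < W by lia.
elim: m s => [|m IH] s Is R; first by apply: R.
have -> : m.+1 * 10 + T = ((m * 10 + T).+1 + 8).+1 by lia.
apply: Runs_bcast => [v|]; first by rewrite aux_view ltW.
apply: (Runs_select (A := F)) => // [|a|a b]; first exact: ltW.
  apply: leq_ltn_trans HW; apply: leq_trans (leq_addr _ _).
  apply: (@leq_trans (\sum_(v < n) \sum_(b : F) n.*2)).
    by apply: leq_sum => v _; apply: leq_sum => b _; rewrite gain_view.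
  by rewrite !sum_nat_const card_ord mulnA mulnC mulnA.
have -> : [ffun u => aux (view G u) s u] = auxv s.
  by apply/ffunP => u; rewrite !ffunE.
move=> avg.
have {}avg : \sum_a' \sum_b' \sum_v gain G s (auxv s) a' b' v <=
    #|F| * #|F| * \sum_v gain G s (auxv s) a b v.
  move: avg; congr (_ <= _ * _); last by apply: eq_bigr => v _.
  by do 3!(apply: eq_bigr => ? _).
apply: Runs_bcast => [v|].
  by have := new_le a b v Is; rewrite ffunE new_view => /ltW.
have -> : [ffun u => new (view G u) s (auxv s) a b u] = newv s a b.
  by apply/ffunP => u; rewrite !ffunE.
apply: IH => [|s' Is' Phis']; first exact: new_Inv.
apply: R => //; rewrite !expnS.
have F0 : 0 < #|F| * #|F| by rewrite muln_gt0 andbb; apply/card_gt0P; exists a0.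
have dec : c.+1 * Phi (newv s a b) <= c * Phi s.
  have := Phi_gain a b Is; set g := \sum_v _ => Pg.
  have : #|F| * #|F| * Phi s <= #|F| * #|F| * (c.+1 * g).
    apply: leq_trans (gain_avg Is) _; rewrite mulnCA leq_mul2l.
    by apply/orP; right; apply: avg.
  by rewrite leq_pmul2l //; nia.
apply: leq_trans (_ : c.+1 * (c ^ m * Phi (newv s a b)) <= _).
  by rewrite -mulnA leq_mul2l Phis' orbT.
by rewrite mulnCA -[c * _ * _]mulnA [c * _]mulnCA leq_mul2l dec orbT.
Qed.

End Phases.

(** Bernoulli's inequality for [(1 + 1/c) ^ k], cleared of denominators. *)
Lemma leq_expnS_bernoulli c k : c ^ k * (c + k) <= c * c.+1 ^ k.
Proof.
elim: k => [|k IH]; first by rewrite !expn0; lia.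
rewrite !expnS; move: (c ^ k) (c.+1 ^ k) IH => x y IH.
have := leq_mul (leqnn c.+1) IH; nia.
Qed.

(** By Bernoulli, [(1 + 1/c) ^ c.+1 >= 2], so each block of [c.+1] phases halves the potential. *)
Lemma leq_decay c L x y : 0 < c ->
  c.+1 ^ (c.+1 * L) * x <= c ^ (c.+1 * L) * y -> 2 ^ L * x <= y.
Proof.
move=> c0; rewrite !expnM => H.
have D : 2 * c ^ c.+1 <= c.+1 ^ c.+1.
  rewrite -(leq_pmul2l c0); apply: leq_trans (leq_expnS_bernoulli c c.+1).
  by move: (c ^ _) => z; nia.
have X0 : 0 < (c ^ c.+1) ^ L by rewrite !expn_gt0 c0.
rewrite -(leq_pmul2l X0); apply: leq_trans H.
rewrite mulnA -expnMn leq_mul2r mulnC; apply/orP; right.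
by case: L {X0} => // L; rewrite leq_exp2r.
Qed.

(** * The whole algorithm, for an abstract phase *)

Section Solve.
Variables (n K c : nat) (F : finType) (a0 : F).
Local Notation vec := {ffun 'I_n -> nat}.
Variable aux : graph n -> vec -> 'I_n -> nat.
Variables gain new : nat -> graph n -> vec -> vec -> F -> F -> 'I_n -> nat.
Variable lst : vec -> 'I_n -> {set 'I_n} -> seq nat.
Variable fin : nat -> vec -> {ffun 'I_n -> seq nat} -> 'I_n -> nat.

(* For [D < K + 16] the whole graph has [O(n)] edges and is published at once. *)
Definition solve (v : 'I_n) (N : {set 'I_n}) : prog n :=
  bcast #|N| (fun deg : vec =>
  let D := \max_u deg u in
  let finish (s : vec) :=
    publish (K + 16) v (lst s v N) (fun Ls => Ret n (fin D s Ls v)) in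
  if K + 16 <= D then
    gather D v N (fun g =>
      phases a0 aux (gain D) (new D) (c.+1 * (trunc_log 2 D).+1) v g [ffun=> 0] finish)
  else finish [ffun=> 0]).

Variables (W : nat) (G : graph n) (Q : ('I_n -> nat) -> Prop).
Variables (Inv : vec -> Prop) (Phi : vec -> nat).
Let D := \max_u #|G u|.
Let auxv s : vec := [ffun v => aux G s v].
Let newv s a b : vec := [ffun v => new D G s (auxv s) a b v].

Hypothesis c0 : 0 < c.
Hypothesis HW : n.*2 * n * #|F| + n.*2 < W.
Hypothesis DK : D ^ 3 <= K * n.
Hypothesis Fn : 0 < n -> #|F| <= n.*2.
Hypothesis aux_view : forall s v, aux (view G v) s v = aux G s v.
Hypothesis gain_view : forall s d a b v,
  gain D (view G v) s d a b v = gain D G s d a b v.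
Hypothesis new_view : forall s d a b v,
  new D (view G v) s d a b v = new D G s d a b v.
Hypothesis aux_le : forall s v, aux G s v <= n.*2.
Hypothesis gain_le : forall s d a b v, gain D G s d a b v <= n.*2.
Hypothesis new_le : forall s a b v, Inv s -> newv s a b v <= n.*2.
Hypothesis new_Inv : forall s a b, Inv s -> Inv (newv s a b).
Hypothesis Phi_gain : forall s a b, Inv s ->
  Phi (newv s a b) + \sum_v gain D G s (auxv s) a b v <= Phi s.
Hypothesis gain_avg : forall s, Inv s -> 16 <= D -> D * D <= n ->
  #|F| * #|F| * Phi s <= c.+1 * \sum_a \sum_b \sum_v gain D G s (auxv s) a b v.
Hypothesis Inv0 : Inv [ffun=> 0].
Hypothesis size_lst : forall s v, size (lst s v (G v)) <= #|G v|.
Hypothesis lst_lt : forall s v x, x \in lst s v (G v) -> x < n.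
Hypothesis sum_lst : forall s, Inv s -> 0 < D -> D * Phi s <= Phi [ffun=> 0] ->
  \sum_v size (lst s v (G v)) <= n.
Hypothesis finQ : forall s, Inv s -> Q (fin D s [ffun u => lst s u (G u)]).

(** If [K + 16 <= D], then [D ^ 3 <= K * n] gives [D * D <= n] and gathering is possible; the
    threshold 16 leaves room for the field size conditions of the averages. Otherwise all lists
    together have at most [(K + 16) * n] entries. *)
Lemma Runs_solve :
  exists T, T <= (c.+1 * 10 + K + 22) * (trunc_log 2 D).+1 /\
            Runs W T (fun v => solve v (G v)) Q.
Proof.
have GD v : #|G v| <= D by exact: leq_bigmax.
have Gn v : #|G v| <= n by rewrite -[X in _ <= X]card_ord max_card.
have fin_runs s : Inv s -> \sum_v size (lst s v (G v)) <= (K + 16) * n ->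
    Runs W (K + 18) (fun v => publish (K + 16) v (lst s v (G v))
      (fun Ls => Ret n (fin D s Ls v))) Q.
  move=> Is szs; have -> : K + 18 = (K + 16 + 0).+2 by lia.
  apply: Runs_publish => //; first by move=> v; apply: leq_trans (Gn v).
  - lia.
  - by move=> v x /lst_lt xn; lia.
  - by exists (fin D s [ffun u => lst s u (G u)]); split=> //; apply: finQ.
have degE : \max_u [ffun u => #|G u|] u = D.
  by apply: eq_bigr => u _; rewrite ffunE.
set L := (trunc_log 2 D).+1.
case: (leqP (K + 16) D) => KD.
- exists ((c.+1 * L * 10 + (K + 18)).+3).+1; split; first by rewrite /L; nia.
  have D2 : D * D <= n.
    have /[!expnS] := DK; rewrite expn0 muln1 => D3.
    have D0 : 0 < D by lia.
    rewrite -(leq_pmul2l D0); apply: leq_trans D3 _.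
    by rewrite leq_mul2r; apply/orP; right; lia.
  have n0 : 0 < n by nia.
  apply: Runs_bcast => [v|]; first by have := Gn v; lia.
  cbv beta zeta; rewrite degE KD; apply: Runs_gather => //; first by lia.
  apply: (Runs_phases a0 (c := c) (Inv := Inv) (Phi := Phi)) => //.
  + exact: Fn.
  + by move=> s Is; apply: gain_avg => //; lia.
  (* The phases divide the potential by at least [2 ^ L], which exceeds [D]. *)
  move=> s Is /(leq_decay c0) dec; apply: fin_runs => //.
  apply: leq_trans (_ : n <= _); last by nia.
  apply: sum_lst => //; first lia; apply: leq_trans dec.
  by rewrite leq_mul2r; apply/orP; right; apply/ltnW/trunc_log_ltn.
exists (K + 18).+1; split; first by nia.
apply: Runs_bcast => [v|]; first by have := Gn v; lia.
cbv beta zeta; rewrite degE leqNgt KD /=; apply: fin_runs => //.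
apply: leq_trans (_ : \sum_(v < n) (K + 16) <= _).
  apply: leq_sum => v _; apply: leq_trans (size_lst _ _) _.
  exact: leq_trans (GD v) (ltnW KD).
by rewrite sum_nat_const card_ord mulnC.
Qed.

End Solve.


(** * Maximal independent set *)

Lemma card_set_le n (A : {set 'I_n}) : #|A| <= n.
Proof. by rewrite -[X in _ <= X]card_ord max_card. Qed.

Lemma card_ltn_ord q t : t <= q -> \sum_(i < q) (i < t : nat) = t.
Proof.
move=> tq; transitivity (\sum_(i < q | i < t) 1).
  by rewrite [RHS]big_mkcond; apply: eq_bigr => i _; case: ltnP.
by rewrite (big_ord_narrow tq) sum1_card card_ord.
Qed.

(** A minimal subset of weight at least [x] falls below [x] when any element is removed, so it
    overshoots by less than one weight. *)
Lemma subset_sum_window (T : finType) (A : {set T}) (t : T -> nat) (x y : nat) :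
  0 < x -> (forall u, u \in A -> t u <= y) -> x <= \sum_(u in A) t u ->
  exists B : {set T}, [/\ B \subset A, x <= \sum_(u in B) t u
                        & \sum_(u in B) t u < x + y].
Proof.
move=> x0 ty xA.
pose heavy (B : {set T}) := x <= \sum_(u in B) t u.
have [B /minsetP[xB minB] BA] := @minset_exists _ heavy A xA.
exists B; split=> //.
case: (set_0Vmem B) => [B0|[u uB]]; first by move: xB; rewrite B0 big_set0; lia.
have : \sum_(w in B :\ u) t w < x.
  rewrite ltnNge; apply/negP => xB'; have := minB _ xB' (subsetDl _ _).
  by move/setP/(_ u); rewrite !inE eqxx uB.
rewrite [in X in _ -> X](big_setD1 u uB) /=.
have := ty u (subsetP BA _ uB); lia.
Qed.

(** Rounding a quotient that is at least 1 down loses at most half of it. *)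
Lemma leq_mul_div q d : 0 < d -> 8 * d <= q -> q <= 16 * (d * (q %/ (8 * d))).
Proof.
move=> d0 dq; have d80 : 0 < 8 * d by rewrite muln_gt0.
have := divn_eq q (8 * d); have := ltn_pmod q d80.
have : 0 < q %/ (8 * d) by rewrite divn_gt0.
move: (q %/ _) (q %% _) => t r t0 rd; rewrite mulnCA (mulnC t).
have := leq_pmulr d t0; move: (d * t) => x; lia.
Qed.

(** With [r = S / q] between 1/48 and 7/48, the hit probability is at least [r * (7/8 - r)], which
    exceeds 1/96. *)
Lemma second_moment_bound q S H U : q <= 48 * S -> 48 * S < 7 * q ->
  q * S <= H + S * S + U -> 8 * U <= S * q -> q * q <= 96 * H.
Proof.
move=> lo hi; rewrite (mulnC S q).
have h1 := leq_mul (leqnn q) lo; have h2 := leq_mul (ltnW hi) (leqnn S).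
rewrite (mulnCA q) in h1; rewrite -!mulnA in h2; move: h1 h2.
move: (q * S) (S * S) (q * q) => x y z; lia.
Qed.

Lemma sum2_add3 (A B : finType) (x y z : A -> B -> nat) :
  \sum_a \sum_b (x a b + y a b + z a b) =
  \sum_a \sum_b x a b + \sum_a \sum_b y a b + \sum_a \sum_b z a b.
Proof.
by rewrite -!big_split /=; apply: eq_bigr => a _; rewrite -!big_split.
Qed.

(** * One phase of Luby's algorithm and its expected gain *)

Section MisStep.
Variables (n : nat) (F : finFieldType).
Local Notation vec := {ffun 'I_n -> nat}.
Implicit Types (g G : graph n) (s d : vec) (a b : F) (u v w : 'I_n).

(** Ties are broken by index, so every edge has exactly one lower and one upper end. *)
Definition deg_lt d u w := (d u < d w) || (d u == d w) && (u < w).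

(* Status 0: undecided, 1: in the set, 2: dominated. *)
Definition mis_aux g s v := #|[set u in g v | s u == 0]|.

(** For [d u = 0] the quotient is 0: an undecided node without undecided neighbours is never marked
    and is left to the local completion. *)
Definition mark_bound d u := #|F| %/ (8 * d u).

Definition marked s d a b u := (s u == 0) && (hash a b u < mark_bound d u).

Definition joins g s d a b u :=
  marked s d a b u && [forall w in g u, marked s d a b w ==> deg_lt d w u].

Definition hit g s d a b v :=
  (s v == 0) && (joins g s d a b v || [exists u in g v, joins g s d a b u]).

Definition lower g s d v := [set u in g v | (s u == 0) && deg_lt d u v].

(** A deleted edge is credited only to its upper end, so never twice; the doubling matches
    [mis_pot], which counts edges from both ends. *)
Definition mis_gain g s d a b v := hit g s d a b v * (#|lower g s d v|).*2.

Definition mis_new g s d a b v :=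
  if s v != 0 then s v
  else if joins g s d a b v then 1
  else if [exists u in g v, joins g s d a b u] then 2 else 0.

Lemma deg_lt_anti d u w : deg_lt d u w -> deg_lt d w u -> False.
Proof. by rewrite /deg_lt; lia. Qed.

Lemma deg_lt_total d u w : u != w -> deg_lt d u w || deg_lt d w u.
Proof. by rewrite /deg_lt -val_eqE /=; lia. Qed.

Lemma joins_view G s d a b v u : u \in v |: G v ->
  joins (view G v) s d a b u = joins G s d a b u.
Proof. by move=> uv; rewrite /joins viewE. Qed.

Lemma exists_joins_view G s d a b v :
  [exists u in view G v v, joins (view G v) s d a b u] =
  [exists u in G v, joins G s d a b u].
Proof.
rewrite view_self; apply: eq_existsb => u.
by case: (boolP (u \in G v)) => // uv; rewrite joins_view // setU1r.
Qed.

Lemma mis_aux_view G s v : mis_aux (view G v) s v = mis_aux G s v.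
Proof. by rewrite /mis_aux view_self. Qed.

Lemma mis_gain_view G s d a b v :
  mis_gain (view G v) s d a b v = mis_gain G s d a b v.
Proof.
by rewrite /mis_gain /hit /lower exists_joins_view joins_view ?setU11 // view_self.
Qed.

Lemma mis_new_view G s d a b v :
  mis_new (view G v) s d a b v = mis_new G s d a b v.
Proof. by rewrite /mis_new exists_joins_view joins_view ?setU11. Qed.

Variable G : graph n.
Hypothesis Gsym : forall u v, (u \in G v) = (v \in G u).
Hypothesis Girr : forall v, v \notin G v.

Definition mis_inv s :=
  [/\ forall v, s v <= 2,
      forall u v, s u = 1 -> v \in G u -> s v = 2
    & forall v, s v = 2 -> exists2 u, u \in G v & s u = 1].

Definition mis_pot s := \sum_(v | s v == 0) mis_aux G s v.

Lemma mis_inv0 : mis_inv [ffun=> 0].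
Proof. by split=> [v|u v|v]; rewrite ffunE. Qed.

Lemma mis_new_inv s d a b : mis_inv s -> mis_inv [ffun v => mis_new G s d a b v].
Proof.
case=> le2 nb1 ex2; split=> [v|u v|v]; rewrite !ffunE.
- by rewrite /mis_new; case: (s v != 0) => //; case: ifP => // _; case: ifP.
- rewrite {1}/mis_new; case: (eqVneq (s u) 0) => [su0|su0] /=.
    case: ifP => [ju _ vu|]; last by case: ifP.
    have uv : u \in G v by rewrite Gsym.
    rewrite /mis_new; case: (eqVneq (s v) 0) => [sv0|sv0] /=.
      case: ifP => [jv|_].
        (* Two adjacent joining nodes would each be below the other. *)
        case: (@deg_lt_anti d u v); [case/andP: jv | case/andP: ju].
          move=> _ /forallP/(_ u); rewrite uv /= => /implyP; apply.
          by case/andP: ju.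
        move=> _ /forallP/(_ v); rewrite vu /= => /implyP; apply.
        by case/andP: jv.
      by case: ifP => // /negbT/existsPn/(_ u); rewrite uv ju.
    have := le2 v; case E: (s v) sv0 => [|[|[|]]] // _ _.
    by have := nb1 v u E uv; rewrite su0.
  move=> su1 vu; have sv2 := nb1 _ _ su1 vu.
  by rewrite /mis_new sv2.
rewrite {1}/mis_new; case: (eqVneq (s v) 0) => [sv0|sv0] /=.
  case: ifP => // _; case: ifP => // /existsP[u /andP[uv ju]] _.
  exists u => //; rewrite ffunE /mis_new ju.
  by case/andP: ju => /andP[-> _].
move=> /ex2[u uv su]; exists u => //; by rewrite ffunE /mis_new su.
Qed.

Lemma card_lower s d v : #|lower G s d v| = \sum_(u in G v | s u == 0) deg_lt d u v.
Proof.
rewrite -sum1_card big_mkcond /= [RHS]big_mkcond /=; apply: eq_bigr => u _.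
by rewrite !inE; case: (u \in G v); case: (s u == 0); case: (deg_lt d u v).
Qed.

Lemma mis_auxE s v : mis_aux G s v = \sum_(u in G v | s u == 0) 1.
Proof. by rewrite /mis_aux -sum1_card; apply: eq_bigl => u; rewrite !inE. Qed.

(** Double counting: both sides number the undecided edges, once from the lower and once from the
    upper end. *)
Lemma sum_lowerC (s d : vec) :
  \sum_(v | s v == 0) \sum_(u in G v | s u == 0) deg_lt d v u =
  \sum_(v | s v == 0) #|lower G s d v|.
Proof.
under [RHS]eq_bigr do rewrite card_lower.
rewrite (exchange_big_dep (fun u => s u == 0)) /=; last by move=> v u _ /andP[].
apply: eq_bigr => v sv; apply: eq_bigl => u.
by rewrite Gsym sv andbT andbC.
Qed.

Lemma aux_lower s d v : mis_aux G s v =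
  #|lower G s d v| + \sum_(u in G v | s u == 0) deg_lt d v u.
Proof.
rewrite mis_auxE card_lower -big_split /=; apply: eq_bigr => u /andP[uv _].
have uv' : u != v by apply: contraTneq uv => ->; rewrite Girr.
have := deg_lt_total d uv'; have := @deg_lt_anti d u v.
by do 2 case: deg_lt => //; move=> /(_ isT isT).
Qed.

Lemma mis_pot_lower s d : mis_pot s = (\sum_(v | s v == 0) #|lower G s d v|).*2.
Proof.
rewrite /mis_pot (eq_bigr _ (fun v _ => aux_lower s d v)) big_split /=.
by rewrite sum_lowerC addnn.
Qed.

(** Both potentials are expressed through the same order [d]. A hit node becomes decided and gives
    up its lower edges, and the lower set of any other node can only shrink. *)
Lemma mis_pot_gain s d a b : mis_pot [ffun v => mis_new G s d a b v] +
  \sum_v mis_gain G s d a b v <= mis_pot s.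
Proof.
rewrite !(mis_pot_lower _ d); set s' := [ffun _ => _].
have s'0 v : s' v == 0 -> s v == 0.
  by rewrite ffunE /mis_new; case: (eqVneq (s v) 0) => //= sv; rewrite (negbTE sv).
have s'hit v : s v == 0 -> hit G s d a b v -> s' v == 0 = false.
  rewrite /hit ffunE /mis_new => -> /= /orP[->|->] //; by case: ifP.
have -> : \sum_v mis_gain G s d a b v =
    (\sum_(v | s v == 0) hit G s d a b v * #|lower G s d v|).*2.
  rewrite -mul2n big_distrr [RHS]big_mkcond; apply: eq_bigr => v _.
  by rewrite /mis_gain /hit; case: (s v == 0) => //=; rewrite mulnCA mul2n.
rewrite -doubleD leq_double big_mkcond [X in _ + X]big_mkcond -big_split /=.
rewrite [leqRHS]big_mkcond; apply: leq_sum => v _.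
case: (boolP (s' v == 0)) => [s'v|_].
  rewrite (s'0 _ s'v); case: (boolP (hit G s d a b v)) => [/(s'hit _ (s'0 _ s'v))|_].
    by rewrite s'v.
  rewrite mul0n addn0; apply/subset_leq_card/subsetP => u; rewrite !inE.
  by move=> /and3P[-> /s'0 -> ->].
by case: (s v == 0) => //; case: (hit _ _ _ _ _ _); rewrite ?mul1n ?mul0n.
Qed.

Hypothesis nF : n <= #|F|.

Lemma sum_marked s d u : s u == 0 ->
  \sum_(a : F) \sum_(b : F) (marked s d a b u : nat) = #|F| * mark_bound d u.
Proof.
move=> su; have E : mark_bound d u <= #|F| by apply: leq_div.
rewrite -[X in _ = _ * X](card_ltn_ord E).
rewrite -(sum_hash _ (fun i => (i < mark_bound d u : nat)) u).
by apply: eq_bigr => a _; apply: eq_bigr => b _; rewrite /marked su.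
Qed.

Lemma sum_marked2 s d u w : s u == 0 -> s w == 0 -> u != w ->
  \sum_(a : F) \sum_(b : F) marked s d a b u * marked s d a b w =
  mark_bound d u * mark_bound d w.
Proof.
move=> su sw uw.
have Eu : mark_bound d u <= #|F| by apply: leq_div.
have Ew : mark_bound d w <= #|F| by apply: leq_div.
rewrite -[X in _ = X * _](card_ltn_ord Eu) -[X in _ = _ * X](card_ltn_ord Ew).
rewrite -(sum_hash2 nF (fun i => (i < mark_bound d u : nat))
           (fun i => (i < mark_bound d w : nat)) uw).
by apply: eq_bigr => a _; apply: eq_bigr => b _; rewrite /marked su sw.
Qed.

Definition upper s d u := [set w in G u | (s w == 0) && ~~ deg_lt d w u].

(* Bonferroni: if no marked node of [B] joins, each is blocked by some marked
   node of its upper neighbourhood. *)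
Lemma hit_bonferroni s d a b v (B : {set 'I_n}) : s v == 0 ->
  B \subset lower G s d v ->
  \sum_(u in B) (marked s d a b u : nat) <=
  hit G s d a b v
  + \sum_(u in B) \sum_(w in B | u != w) marked s d a b u * marked s d a b w
  + \sum_(u in B) \sum_(w in upper s d u) marked s d a b u * marked s d a b w.
Proof.
move=> sv /subsetP BL; pose m u := (marked s d a b u : nat).
case: (boolP (hit G s d a b v)) => [_|nohit]; last first.
  apply: leq_trans (leq_addl _ _); apply: leq_sum => u uB.
  case: (boolP (marked s d a b u)) => // mu.
  have := BL _ uB; rewrite inE => /and3P[uv su _].
  have : ~~ joins G s d a b u.
    by apply: contra nohit => ju; rewrite /hit sv; apply/orP; right;
       apply/existsP; exists u; rewrite uv.
  rewrite /joins mu /= => /forallPn[w]; rewrite !negb_imply => /and3P[wu mw dw].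
  have sw : s w == 0 by case/andP: mw.
  by rewrite (bigD1 w) /= ?inE ?wu ?sw ?dw // mw leq_addr.
apply: leq_trans (leq_addr _ _).
(* On a hit, the 1 pays for one marked [u0] in [B], and the pair of [u0] and [w] pays for every
   other marked [w]. *)
case: (pickP (fun u => (u \in B) && marked s d a b u)) => [u0 /andP[u0B mu0]|none].
  rewrite (bigD1 u0) //= mu0 leq_add2l.
  apply: leq_trans (_ : \sum_(w in B | u0 != w) m u0 * m w <= _).
    by rewrite /m mu0; under [leqRHS]eq_bigl do rewrite eq_sym;
       apply: leq_sum => w _; rewrite mul1n.
  by rewrite (bigD1 (P := fun u => u \in B) u0) //= leq_addr.
rewrite big1 // => u uB; by have := none u; rewrite uB /= => ->.
Qed.

(** There are at most [d u] upper neighbours, each of degree at least [d u], so the expected number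
    of marked ones is at most 1/8. *)
Lemma sum_upper_bound s u (d := [ffun v => mis_aux G s v]) :
  8 * \sum_(w in upper s d u) mark_bound d w <= #|F|.
Proof.
have le_d : #|upper s d u| <= d u.
  rewrite ffunE; apply/subset_leq_card/subsetP => w; rewrite !inE.
  by case/and3P => -> -> _.
have dw w : w \in upper s d u -> d u <= d w.
  by rewrite !inE => /and3P[_ _]; rewrite negb_or -leqNgt => /andP[].
case: (posnP (d u)) => [d0|d0].
  suff -> : upper s d u = set0 by rewrite big_set0 muln0.
  by apply/eqP; rewrite -cards_eq0 -leqn0 -d0.
apply: leq_trans (_ : 8 * (d u * mark_bound d u) <= _).
  rewrite leq_mul2l /=; apply: leq_trans (_ : \sum_(w in upper s d u) mark_bound d u <= _).
    apply: leq_sum => w /dw le; apply: leq_div2l; first by rewrite muln_gt0.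
    by rewrite leq_mul2l.
  by rewrite sum_nat_const leq_mul2r le_d orbT.
by rewrite mulnA mulnC leq_trunc_div.
Qed.

(** A third of the neighbours of [v] are lower ones, each marked with probability at least
    [1 / (16 * d v)], so at least 1/48 marks are expected among them. Bonferroni turns this into a
    probability, pairwise independence evaluating the products. *)
Lemma hit_frequency s v (d := [ffun v => mis_aux G s v]) :
  s v == 0 -> 8 * d v <= #|F| -> 0 < d v -> d v <= 3 * #|lower G s d v| ->
  #|F| * #|F| <= 96 * \sum_(a : F) \sum_(b : F) hit G s d a b v.
Proof.
move=> sv dF d0 good; set q := #|F|.
pose t u := mark_bound d u.
have q0 : 0 < q by apply/card_gt0P; exists 0%R.
have lowP u : u \in lower G s d v -> [/\ s u == 0, 0 < d u & d u <= d v].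
  rewrite inE => /and3P[uv su lt]; split=> //; last by case/orP: lt => [/ltnW|/andP[/eqP ->]].
  by rewrite ffunE; apply/card_gt0P; exists v; rewrite inE -Gsym uv.
have tv : q <= 16 * (d v * t v) by exact: leq_mul_div.
have S0 : q <= \sum_(u in lower G s d v) 48 * t u.
  apply: leq_trans (_ : \sum_(u in lower G s d v) 48 * t v <= _); last first.
    apply: leq_sum => u /lowP[_ du dle]; rewrite leq_mul2l /=.
    by apply: leq_div2l; rewrite ?muln_gt0 // leq_mul2l.
  rewrite sum_nat_const mulnCA; apply: leq_trans tv _.
  rewrite -[48]/(16 * 3) -mulnA leq_mul2l mulnA leq_mul2r /=.
  by rewrite good orbT.
(* The lower set is trimmed to keep the quadratic term [S * S] small; one weight [48 * t u] is at
   most [6 * q], whence the window from [q] to [7 * q]. *)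
have [u /lowP[_ du _]|B [BL SB SB']] := subset_sum_window (y := 6 * q) q0 _ S0.
  rewrite -[48]/(6 * 8) -mulnA leq_mul2l /=.
  apply: leq_trans (leq_trunc_div q (8 * d u)).
  by rewrite mulnC leq_mul2l leq_pmulr // orbT.
move: SB SB'; rewrite -big_distrr /=; set S := \sum_(u in B) t u => SB SB'.
have BlowP u : u \in B -> s u == 0 by move=> /(subsetP BL)/lowP[].
set H := \sum_a _.
have main : q * S <= H + S * S + \sum_(u in B) \sum_(w in upper s d u) t u * t w.
  have -> : q * S = \sum_(a : F) \sum_(b : F) \sum_(u in B) (marked s d a b u : nat).
    rewrite big_distrr /=.
    under [RHS]eq_bigr do rewrite exchange_big /=.
    rewrite exchange_big /=; apply: eq_bigr => u /BlowP su.
    by rewrite sum_marked.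
  apply: leq_trans (_ : \sum_(a : F) \sum_(b : F) (hit G s d a b v
    + \sum_(u in B) \sum_(w in B | u != w) marked s d a b u * marked s d a b w
    + \sum_(u in B) \sum_(w in upper s d u) marked s d a b u * marked s d a b w) <= _).
    by apply: leq_sum => a _; apply: leq_sum => b _; apply: hit_bonferroni.
  rewrite sum2_add3 -/H -!addnA leq_add2l.
  apply: leq_add.
    under eq_bigr do rewrite exchange_big /=.
    rewrite exchange_big /= /S big_distrl /=; apply: leq_sum => u uB.
    under eq_bigr do rewrite exchange_big /=.
    rewrite exchange_big /= big_distrr /= big_mkcondr /=; apply: leq_sum => w wB.
    by case: ifP => // uw; rewrite sum_marked2 ?BlowP.
  under eq_bigr do rewrite exchange_big /=.
  rewrite exchange_big /=; apply: leq_sum => u uB.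
  under eq_bigr do rewrite exchange_big /=.
  rewrite exchange_big /=; apply: leq_sum => w.
  rewrite inE => /and3P[wu sw _]; rewrite (sum_marked2 _ (BlowP u uB) sw) //.
  by apply: contraTneq wu => <-; rewrite Girr.
have up : 8 * \sum_(u in B) \sum_(w in upper s d u) t u * t w <= S * q.
  rewrite big_distrr /= /S big_distrl /=; apply: leq_sum => u _.
  rewrite -big_distrr /= mulnCA leq_mul2l sum_upper_bound; exact: orbT.
apply: second_moment_bound main up => //; rewrite -/S; lia.
Qed.

(** At least half of the edges have a good upper end, which is hit with probability at least 1/96;
    this gives 192. *)
Lemma mis_gain_avg s (d := [ffun v => mis_aux G s v]) :
  (forall v, 8 * #|G v| <= #|F|) ->
  #|F| * #|F| * mis_pot s <=
  192 * \sum_(a : F) \sum_(b : F) \sum_v mis_gain G s d a b v.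
Proof.
move=> GF; set q2 := #|F| * #|F|.
pose lo v := #|lower G s d v|.
pose hi v := \sum_(u in G v | s u == 0) deg_lt d v u.
have -> : \sum_(a : F) \sum_(b : F) \sum_v mis_gain G s d a b v =
   \sum_v (lo v).*2 * \sum_(a : F) \sum_(b : F) hit G s d a b v.
  under [LHS]eq_bigr do rewrite exchange_big /=.
  rewrite exchange_big /=; apply: eq_bigr => v _.
  rewrite big_distrr /=; apply: eq_bigr => a _; rewrite big_distrr /=.
  by apply: eq_bigr => b _; rewrite /mis_gain mulnC.
pose good v := d v <= 3 * lo v.
(* Bad nodes have at least twice as many upper as lower neighbours, so at
   least half of the edges have a good upper end. *)
have half : \sum_(v | s v == 0) lo v <= 2 * \sum_(v | (s v == 0) && good v) lo v.
  have Ehi : \sum_(v | s v == 0) hi v = \sum_(v | s v == 0) lo v by exact: sum_lowerC.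
  have : 2 * \sum_(v | (s v == 0) && ~~ good v) lo v <= \sum_(v | s v == 0) hi v.
    rewrite big_distrr /= [leqRHS](bigID good) /=; apply: leq_trans (leq_addl _ _).
    apply: leq_sum => v /andP[_]; rewrite /good ffunE (aux_lower s d) -/(lo v) -/(hi v).
    lia.
  rewrite Ehi; rewrite (bigID good (fun v => s v == 0)) /=; lia.
have key v : (s v == 0) && good v ->
    q2 * lo v <= 96 * (lo v * \sum_(a : F) \sum_(b : F) hit G s d a b v).
  case/andP => sv gv; case: (posnP (lo v)) => [->|lo0]; first by rewrite muln0.
  have d0 : 0 < d v.
    by rewrite ffunE (aux_lower s d) -/(lo v); lia.
  have dF : 8 * d v <= #|F|.
    apply: leq_trans (GF v); rewrite leq_mul2l ffunE /=.
    by apply/subset_leq_card/subsetP => u; rewrite inE => /andP[].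
  rewrite mulnCA mulnC leq_mul2l hit_frequency ?orbT //.
rewrite (mis_pot_lower s d).
apply: leq_trans (_ : 4 * \sum_(v | (s v == 0) && good v) q2 * lo v <= _).
  rewrite -big_distrr /= mulnCA leq_mul2l -mul2n -[4]/(2 * 2) -mulnA.
  by rewrite leq_mul2l half !orbT.
apply: leq_trans (_ : 4 * \sum_(v | (s v == 0) && good v)
   96 * (lo v * \sum_(a : F) \sum_(b : F) hit G s d a b v) <= _).
  by rewrite leq_mul2l /=; apply: leq_sum.
rewrite -big_distrr /= mulnA -[4 * 96]/(192 * 2) -mulnA leq_mul2l /= big_distrr /=.
rewrite [leqLHS]big_mkcond; apply: leq_sum => v _.
by case: ifP => // _; rewrite mulnA mul2n.
Qed.

End MisStep.

(** * Local completion of the independent set *)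

Section MisFinish.
Variable n : nat.
Local Notation vec := {ffun 'I_n -> nat}.
Implicit Types (s : vec) (u v : 'I_n).

Definition mis_lst (s : vec) (v : 'I_n) (N : {set 'I_n}) : seq nat :=
  if s v == 0 then map val (enum [set u in N | s u == 0]) else [::].

Definition mis_rest (s : vec) (Ls : {ffun 'I_n -> seq nat}) (I : {set 'I_n}) :=
  [&& I \subset [set v | s v == 0],
      [forall u in I, forall v in I, val v \notin Ls u]
    & [forall v, (s v == 0) ==> (v \in I) || [exists u in I, val u \in Ls v]]].

(** All nodes evaluate the same [pick] on the same published data, so they agree on one set without
    communication. *)
Definition mis_fin (s : vec) (Ls : {ffun 'I_n -> seq nat}) (v : 'I_n) : nat :=
  if s v == 0 then
    if [pick J | mis_rest s Ls J] is Some J then nat_of_bool (v \in J) else 0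
  else s v == 1.

Variable G : graph n.
Hypothesis Gsym : forall u v, (u \in G v) = (v \in G u).
Hypothesis Girr : forall v, v \notin G v.

Lemma mem_mis_lst (s : vec) (u v : 'I_n) : s v == 0 ->
  (val u \in mis_lst s v (G v)) = (u \in G v) && (s u == 0).
Proof.
by move=> sv; rewrite /mis_lst sv mem_map ?mem_enum ?inE //; apply: val_inj.
Qed.

(** An inclusion-maximal independent set of undecided nodes qualifies: an undominated node could be
    added to it. *)
Lemma mis_rest_exists s : exists I, mis_rest s [ffun u => mis_lst s u (G u)] I.
Proof.
pose indep (I : {set 'I_n}) := (I \subset [set v | s v == 0]) &&
  [forall u in I, forall v in I, v \notin G u].
have [|I /maxsetP[/andP[sI /forall_inP iI] maxI] _] :=
  @maxset_exists _ indep set0.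
  by rewrite /indep sub0set; apply/forall_inP => u; rewrite inE.
have sI0 u : u \in I -> s u == 0 by move/(subsetP sI); rewrite inE.
exists I; apply/and3P; split=> //.
  apply/forall_inP => u uI; apply/forall_inP => v vI.
  by rewrite ffunE mem_mis_lst ?sI0 // andbT; have /forall_inP/(_ v vI) := iI u uI.
apply/forallP => v; apply/implyP => sv; apply/norP => -[vI].
move/existsPn => no; have {}no u : u \in I -> u \notin G v.
  by move=> uI; have := no u; rewrite uI ffunE mem_mis_lst // sI0 // andbT.
have : indep (v |: I).
  apply/andP; split.
    by apply/subsetP => u; rewrite !inE => /predU1P[->|/sI0].
  apply/forall_inP => u; rewrite !inE => /predU1P[->|uI]; apply/forall_inP => w;
    rewrite !inE => /predU1P[->|wI].
  - exact: Girr.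
  - exact: no.
  - by rewrite Gsym no.
  - by have /forall_inP/(_ w wI) := iI u uI.
by move/maxI => /(_ (subsetU1 _ _))/setP/(_ v); rewrite setU11 (negbTE vI).
Qed.

(** Edges between undecided nodes are settled by the picked set, the others by the invariant, under
    which every neighbour of a status 1 node has status 2. *)
Lemma mis_finP s (f := mis_fin s [ffun u => mis_lst s u (G u)]) : mis_inv G s ->
  [/\ forall v, f v <= 1,
      forall u v, v \in G u -> ~ (f u = 1 /\ f v = 1)
    & forall v, f v = 0 -> exists2 u, u \in G v & f u = 1].
Proof.
case=> le2 nb1 ex2; rewrite /f /mis_fin.
case: pickP => [I /and3P[/subsetP sI /forall_inP iI /forallP mI]|none]; last first.
  by have [I] := mis_rest_exists s; rewrite none.
have sI0 u : u \in I -> s u == 0 by move/sI; rewrite inE.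
split=> [v|u v vu|v].
- by case: ifP => _; apply: leq_b1.
- case: (boolP (s u == 0)) => su; case: (boolP (s v == 0)) => sv [fu fv].
  + have uI : u \in I by move: fu; case: (u \in I).
    have vI : v \in I by move: fv; case: (v \in I).
    have /forall_inP/(_ v vI) := iI u uI.
    by rewrite ffunE mem_mis_lst // vu sv.
  + have sv1 : s v = 1 by move: fv; case: eqP.
    by have := nb1 v u sv1; rewrite Gsym vu (eqP su) => /(_ isT).
  + have su1 : s u = 1 by move: fu; case: eqP.
    by have := nb1 u v su1 vu; rewrite (eqP sv).
  + have su1 : s u = 1 by move: fu; case: eqP.
    have sv1 : s v = 1 by move: fv; case: eqP.
    by have := nb1 u v su1 vu; rewrite sv1.
case: (boolP (s v == 0)) => sv.
  case: (boolP (v \in I)) => // vI _; have := mI v; rewrite sv (negbTE vI) /=.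
  case/existsP => u /andP[uI]; rewrite ffunE mem_mis_lst // => /andP[uv su].
  by exists u => //; rewrite su uI.
have := le2 v; case E: (s v) sv => [|[|[|]]] // _ _ _.
by have [u uv su] := ex2 v E; exists u => //; rewrite su.
Qed.

Lemma sum_mis_lst s : \sum_v size (mis_lst s v (G v)) = mis_pot G s.
Proof.
rewrite /mis_pot [RHS]big_mkcond; apply: eq_bigr => v _.
by rewrite /mis_lst; case: ifP => // _; rewrite size_map -cardE.
Qed.

End MisFinish.

(** The 191 stands for [c] with [c.+1 = 192]; the rounds then sum to the constant
    [192 * 10 + K + 22 = K + 1942]. *)
Definition mis_prog (K n : nat) : 'I_n -> {set 'I_n} -> prog n :=
  let F := seed_field n in
  solve K 191 (0%R : F) (@mis_aux n)
    (fun _ => @mis_gain n F) (fun _ => @mis_new n F) (@mis_lst n) (fun _ => @mis_fin n).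

Lemma mis_prog_runs K n (G : graph n) :
  (forall u v, (u \in G v) = (v \in G u)) -> (forall v, v \notin G v) ->
  (\max_v #|G v|) ^ 3 <= K * n ->
  exists T, T <= (K + 1942) * (trunc_log 2 (\max_v #|G v|)).+1 /\
    Runs (2 ^ (5 * bits n)) T (fun v => mis_prog K v (G v)) (fun f =>
      [/\ forall v, f v <= 1,
          forall u v, v \in G u -> ~ (f u = 1 /\ f v = 1)
        & forall v, f v = 0 -> exists2 u, u \in G v & f u = 1]).
Proof.
move=> Gsym Girr DK; set D := \max_v _ in DK *.
have GD v : #|G v| <= D by exact: leq_bigmax.
have nF := ltn_card_seed_field n; have Fn := @card_seed_field_le n.
have HW := seed_message_bound n.
have [] := @Runs_solve n K 191 (seed_field n) 0%R (@mis_aux n)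
    (fun _ => @mis_gain n (seed_field n)) (fun _ => @mis_new n (seed_field n))
    (@mis_lst n) (fun _ => @mis_fin n) (2 ^ (5 * bits n)) G
    (fun f => [/\ forall v, f v <= 1,
          forall u v, v \in G u -> ~ (f u = 1 /\ f v = 1)
        & forall v, f v = 0 -> exists2 u, u \in G v & f u = 1])
    (mis_inv G) (mis_pot G) => //; last first.
- move=> T [TD R]; exists T; split=> //.
  by apply: leq_trans TD _; rewrite leq_mul2r; apply/orP; right; lia.
- by move=> s Is; apply: mis_finP.
(* The initial potential is at most [n * D], so a potential reduced by the factor [D] is at most
   [n]. *)
- move=> s _ D0 Dpot; rewrite sum_mis_lst -(leq_pmul2l D0).
  apply: leq_trans Dpot _; rewrite /mis_pot.
  apply: leq_trans (_ : \sum_(v < n) D <= _).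
    rewrite [leqLHS]big_mkcond; apply: leq_sum => v _; case: ifP => // _.
    apply: leq_trans (GD v); apply/subset_leq_card/subsetP => u.
    by rewrite inE => /andP[].
  by rewrite sum_nat_const card_ord mulnC.
- move=> s v x; rewrite /mis_lst; case: ifP => // _ /mapP[u _ ->]; exact: ltn_ord.
- move=> s v; rewrite /mis_lst; case: ifP => // _; rewrite size_map -cardE.
  by apply/subset_leq_card/subsetP => u; rewrite inE => /andP[].
- exact: mis_inv0.
- move=> s Is D16 D2; apply: mis_gain_avg => //; first exact: ltnW.
  by move=> v; have := GD v; nia.
- by move=> s a b Is; apply: mis_pot_gain.
- by move=> s a b Is; apply: mis_new_inv.
- move=> s a b v Is; have [le2 _ _] := mis_new_inv Gsym [ffun v => mis_aux G s v] a b Is.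
  by apply: leq_trans (le2 v) _; have := ltn_ord v; lia.
- move=> s d a b v; rewrite /mis_gain.
  have := card_set_le (lower G s d v); case: hit => /=; lia.
- by move=> s v; apply: leq_trans (card_set_le _) _; lia.
- by move=> s d a b v; apply: mis_new_view.
- by move=> s d a b v; apply: mis_gain_view.
- by move=> s v; apply: mis_aux_view.
Qed.


(** * Coloring *)

Lemma sum_eq_count (T : eqType) (x : T) (r : seq T) :
  \sum_(c <- r) (x == c : nat) = count_mem x r.
Proof.
rewrite -sum1_count [RHS]big_mkcond; apply: eq_bigr => c _ /=.
by rewrite [x == c]eq_sym; case: (c == x).
Qed.

(** * One phase of random color trials and its expected gain *)

Section ColStep.
Variables (n : nat) (F : finFieldType).
Local Notation vec := {ffun 'I_n -> nat}.
Implicit Types (g G : graph n) (s d : vec) (a b : F) (u v w : 'I_n) (c D : nat).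

Definition palette D g s u := [seq c <- iota 1 D.+1 | [forall w in g u, s w != c]].

Definition block D g s u := #|F| %/ (2 * size (palette D g s u)).

(* Each palette color is chosen by [block] hash values, about half of them in
   total; on the other hash values the node stays silent (value 0). *)
Definition choice D g s a b u :=
  if s u == 0 then nth 0 (palette D g s u) (hash a b u %/ block D g s u) else 0.

Definition colored D g s a b v :=
  [&& s v == 0, choice D g s a b v != 0
    & [forall u in g v, choice D g s a b u != choice D g s a b v]].

Definition col_aux (g : graph n) (s : vec) (v : 'I_n) := 0.

Definition col_gain D g s d a b v : nat := colored D g s a b v.

Definition col_new D g s d a b v :=
  if colored D g s a b v then choice D g s a b v else s v.

Lemma choice_view D G s a b v u : u \in v |: G v ->
  choice D (view G v) s a b u = choice D G s a b u.
Proof. by move=> uv; rewrite /choice /block /palette viewE. Qed.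

Lemma colored_view D G s a b v : colored D (view G v) s a b v = colored D G s a b v.
Proof.
rewrite /colored choice_view ?setU11 // view_self; congr [&& _, _ & _].
apply: eq_forallb => u; case: (boolP (u \in G v)) => //= uv.
by rewrite choice_view // setU1r.
Qed.

Lemma col_new_view D G s d a b v :
  col_new D (view G v) s d a b v = col_new D G s d a b v.
Proof. by rewrite /col_new colored_view choice_view ?setU11. Qed.

Variables (G : graph n) (D : nat).
Hypothesis Gsym : forall u v, (u \in G v) = (v \in G u).
Hypothesis Girr : forall v, v \notin G v.
Hypothesis GD : forall v, #|G v| <= D.

Local Notation pal := (palette D G).

Definition col_inv s :=
  (forall v, s v <= D.+1) /\ (forall u v, v \in G u -> s u = s v -> s u = 0).

Definition col_pot s := #|[set v | s v == 0]|.

Lemma mem_palette s u c :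
  (c \in pal s u) = [&& 0 < c, c <= D.+1 & [forall w in G u, s w != c]].
Proof. by rewrite mem_filter mem_iota add1n ltnS andbC -andbA. Qed.

Lemma uniq_palette s u : uniq (pal s u).
Proof. by rewrite filter_uniq ?iota_uniq. Qed.

Lemma sum_mem_palette s u x : \sum_(c <- pal s u) (x == c : nat) <= (x != 0).
Proof.
rewrite sum_eq_count count_uniq_mem ?uniq_palette // mem_palette.
by case: x => //= x; apply: leq_b1.
Qed.

Lemma size_palette_le s u : size (pal s u) <= D.+1.
Proof. by rewrite size_filter; apply: leq_trans (count_size _ _) _; rewrite size_iota. Qed.

(** Of [D.+1] colors, each colored neighbour excludes at most one, and there are at most [D]
    neighbours in all. *)
Lemma size_palette_gt s u : \sum_(w in G u) (s w == 0 : nat) < size (pal s u).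
Proof.
have cardG : \sum_(w in G u) (s w == 0 : nat) + \sum_(w in G u) (s w != 0 : nat) <= D.
  rewrite -big_split /=; apply: leq_trans (GD u); rewrite -sum1_card.
  by apply: leq_sum => w _; case: eqP.
suff : D.+1 <= size (pal s u) + \sum_(w in G u) (s w != 0 : nat) by lia.
rewrite size_filter -[leqLHS](size_iota 1).
rewrite -(count_predC (fun c => [forall w in G u, s w != c])).
rewrite leq_add2l -sum1_count big_mkcond /=.
apply: leq_trans (_ : \sum_(c <- iota 1 D.+1) \sum_(w in G u) (s w == c : nat) <= _).
  apply: leq_sum => c _; case: ifP => // /forallPn[w]; rewrite negb_imply negbK.
  by case/andP => wu sw; rewrite (bigD1 w) //= sw.
rewrite exchange_big; apply: leq_sum => w _.
rewrite sum_eq_count count_uniq_mem ?iota_uniq // mem_iota.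
by case: (s w) => //= x; apply: leq_b1.
Qed.

Lemma choice_palette s a b u : choice D G s a b u != 0 -> choice D G s a b u \in pal s u.
Proof.
rewrite /choice; case: ifP => // _; set i := _ %/ _.
case: (ltnP i (size (pal s u))) => ip; first by rewrite mem_nth.
by rewrite nth_default.
Qed.

Lemma col_inv0 : col_inv [ffun=> 0].
Proof. by split=> [v|u v _]; rewrite ffunE. Qed.

(** Two newly colored neighbours differ by the test in [colored]; a new and an old color differ
    because palettes exclude the colors of neighbours. *)
Lemma col_new_inv s d a b : col_inv s -> col_inv [ffun v => col_new D G s d a b v].
Proof.
case=> leD prop.
have okP v : colored D G s a b v -> choice D G s a b v \in pal s v.
  by case/and3P => _ + _; apply: choice_palette.
split=> [v|u v vu]; rewrite !ffunE /col_new.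
  by case: ifP => // /okP; rewrite mem_palette => /and3P[].
case: (boolP (colored D G s a b u)) => cu; case: (boolP (colored D G s a b v)) => cv.
- case/and3P: cu => _ _ /forall_inP/(_ v vu); by rewrite eq_sym => /eqP.
- move=> E; move: (okP u cu); rewrite mem_palette => /and3P[_ _ /forall_inP/(_ v vu)].
  by rewrite E eqxx.
- move=> E; move: (okP v cv); rewrite mem_palette => /and3P[_ _ /forall_inP/(_ u)].
  by rewrite Gsym E eqxx => /(_ vu).
- exact: prop.
Qed.

Lemma col_potE s : col_pot s = \sum_v (s v == 0 : nat).
Proof.
rewrite /col_pot -sum1_card big_mkcond; apply: eq_bigr => v _.
by rewrite inE; case: eqP.
Qed.

Lemma col_pot_gain s d a b : col_pot [ffun v => col_new D G s d a b v] +
  \sum_v col_gain D G s d a b v <= col_pot s.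
Proof.
rewrite !col_potE -big_split /=; apply: leq_sum => v _.
rewrite ffunE /col_new /col_gain; case: ifP => [|_]; last by rewrite addn0.
by case/and3P => -> /negbTE -> _.
Qed.

Hypothesis nF : n <= #|F|.
Hypothesis DF : 4 * D.+1 <= #|F|.

Lemma palette_gt0 s u : 0 < size (pal s u).
Proof. exact: leq_ltn_trans (size_palette_gt s u). Qed.

Lemma block_gt0 s u : 0 < block D G s u.
Proof.
rewrite divn_gt0 ?muln_gt0 ?palette_gt0 //.
have := size_palette_le s u; lia.
Qed.

Lemma palette_block_le s u : 2 * (size (pal s u) * block D G s u) <= #|F|.
Proof. by rewrite mulnA mulnC leq_trunc_div. Qed.

(** The remainder of the division is below twice the palette size, hence at most half of [#|F|]; so
    a node tries a color with probability at least 1/4. *)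
Lemma palette_block_ge s u : #|F| <= 4 * (size (pal s u) * block D G s u).
Proof.
have := divn_eq #|F| (2 * size (pal s u)); rewrite -/(block D G s u).
have p0 : 0 < 2 * size (pal s u) by rewrite muln_gt0 palette_gt0.
have := ltn_pmod #|F| p0; have := size_palette_le s u.
rewrite mulnCA (mulnC (block _ _ _ _)); move: (size _ * _) => x; lia.
Qed.

(** The trial color as a function of the hash value alone, the form in which [sum_hash] and
    [sum_hash2] apply. *)
Definition chosen s u i := nth 0 (pal s u) (i %/ block D G s u).

Lemma sum_chosen s u :
  \sum_(i < #|F|) (chosen s u i != 0 : nat) = size (pal s u) * block D G s u.
Proof.
have le : size (pal s u) * block D G s u <= #|F|.
  by have := palette_block_le s u; lia.
rewrite -[RHS](card_ltn_ord le); apply: eq_bigr => i _; congr nat_of_bool.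
rewrite -ltn_divLR ?block_gt0 // /chosen.
case: ltnP => ip; last by rewrite nth_default.
by have := mem_nth 0 ip; rewrite mem_palette; case: (nth _ _ _).
Qed.

(** The hash values that select [c] lie in the interval of length [block] starting at [j * w], with
    [j] the position of [c] in the palette. *)
Lemma sum_chosen1 s u c : c \in pal s u ->
  \sum_(i < #|F|) (chosen s u i == c : nat) <= block D G s u.
Proof.
move=> cP; pose j := index c (pal s u).
have jp : j < size (pal s u) by rewrite index_mem.
set w := block D G s u.
have w0 : 0 < w by exact: block_gt0.
have le1 : j.+1 * w <= #|F|.
  by have := palette_block_le s u; have := leq_mul jp (leqnn w); rewrite -/w; lia.
have le0 : j * w <= #|F| by apply: leq_trans le1; rewrite leq_mul2r leqnSn orbT.
suff : \sum_(i < #|F|) (chosen s u i == c : nat) + j * w <= j.+1 * w by rewrite mulSn; lia.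
rewrite -{1}(card_ltn_ord le0) -(card_ltn_ord le1) -big_split /=.
apply: leq_sum => i _; rewrite -!ltn_divLR // /chosen -/w ltnS.
case: (ltnP (i %/ w) j) => ij.
  rewrite (ltnW ij) addn1 ltnS leqn0 eqb0; apply/eqP => E.
  have : index c (pal s u) = i %/ w.
    by rewrite -E index_uniq ?uniq_palette // (ltn_trans ij).
  by rewrite -/j; lia.
rewrite addn0; case: (eqVneq (i %/ w) j) => [->|ne]; first by rewrite leqnn leq_b1.
case: eqP => // E; case/negP: ne; apply/eqP.
case: (ltnP (i %/ w) (size (pal s u))) => ip.
  by rewrite /j -E index_uniq ?uniq_palette.
by move: cP; rewrite -E nth_default // mem_palette.
Qed.

(** A given uncolored neighbour collides with probability at most [w / (2 * q)], and there are fewer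
    than [p] of them. Collisions thus cost at most half of the trial probability [p * w / q >= 1/4],
    leaving 1/8. *)
Lemma colored_frequency s v : s v == 0 ->
  #|F| * #|F| <= 8 * \sum_(a : F) \sum_(b : F) (colored D G s a b v : nat).
Proof.
move=> sv; set q := #|F|; set C := \sum_a _.
set p := size (pal s v); set w := block D G s v.
have choiceE a b u : s u == 0 -> choice D G s a b u = chosen s u (hash a b u).
  by rewrite /choice => ->.
have main : q * (p * w) <= C + \sum_(u in G v | s u == 0) w * (size (pal s u) * block D G s u).
  rewrite /q -sum_chosen -(sum_hash F (fun i => (chosen s v i != 0 : nat)) v).
  apply: leq_trans (_ : \sum_(a : F) \sum_(b : F) (colored D G s a b v +
     \sum_(u in G v | s u == 0) \sum_(c <- pal s v)
       (chosen s v (hash a b v) == c) * (chosen s u (hash a b u) == c)) <= _).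
    apply: leq_sum => a _; apply: leq_sum => b _.
    case: (boolP (colored D G s a b v)) => [_|nc].
      by apply: leq_trans (leq_addr _ _); apply: leq_b1.
    case: eqP => //= /eqP nz; rewrite add0n.
    move: nc; rewrite /colored sv choiceE // nz /= => /forallPn[u].
    rewrite negb_imply negbK => /andP[uv /eqP E].
    (* Colored neighbours choose 0, so a clash on a nonzero color comes from an uncolored one. *)
    have su : s u == 0.
      by move: E nz; rewrite /choice; case: ifP => // _ <-; rewrite eqxx.
    have cP : chosen s v (hash a b v) \in pal s v.
      by rewrite -choiceE // choice_palette // choiceE.
    rewrite (bigD1 u) /= ?uv //; apply: leq_trans (leq_addr _ _).
    rewrite (big_rem _ cP) /= eqxx -choiceE // E eqxx; exact: leq_addr.
  have -> : \sum_(a : F) \sum_(b : F) (colored D G s a b v +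
     \sum_(u in G v | s u == 0) \sum_(c <- pal s v)
       (chosen s v (hash a b v) == c) * (chosen s u (hash a b u) == c)) =
     C + \sum_(u in G v | s u == 0) \sum_(c <- pal s v) \sum_(a : F) \sum_(b : F)
       (chosen s v (hash a b v) == c) * (chosen s u (hash a b u) == c).
    under [LHS]eq_bigr do rewrite big_split /=.
    rewrite big_split /= -/C; congr (_ + _).
    under [LHS]eq_bigr do rewrite exchange_big /=.
    rewrite exchange_big /=; apply: eq_bigr => u _.
    under [LHS]eq_bigr do rewrite exchange_big /=.
    by rewrite exchange_big.
  rewrite leq_add2l; apply: leq_sum => u /andP[uv su].
  have vu : v != u by apply: contraTneq uv => ->; rewrite Girr.
  apply: leq_trans (_ : \sum_(c <- pal s v) w * \sum_(i < #|F|) (chosen s u i == c : nat) <= _).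
    rewrite !big_seq; apply: leq_sum => c cP.
    rewrite (sum_hash2 nF (fun i => (chosen s v i == c : nat))
              (fun i => (chosen s u i == c : nat)) vu).
    by rewrite leq_mul2r sum_chosen1 ?orbT.
  rewrite -big_distrr leq_mul2l /= -sum_chosen exchange_big /=; apply/orP; right.
  by apply: leq_sum => i _; apply: sum_mem_palette.
have nbrs : 2 * \sum_(u in G v | s u == 0) w * (size (pal s u) * block D G s u) <= p * (w * q).
  rewrite big_distrr /=.
  apply: leq_trans (_ : \sum_(u in G v | s u == 0) w * q <= _).
    by apply: leq_sum => u _; rewrite mulnCA leq_mul2l palette_block_le orbT.
  rewrite sum_nat_const leq_mul2r; apply/orP; right.
  apply: leq_trans (ltnW (size_palette_gt s v)); rewrite -sum1_card big_mkcond [leqRHS]big_mkcond.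
  apply: leq_sum => u _; rewrite unfold_in /=.
  by case: (u \in G v); case: eqP.
have pw : q <= 4 * (p * w) by exact: palette_block_ge.
have h1 := leq_mul (leqnn q) pw; rewrite (mulnCA q) in h1.
move: main nbrs h1; have -> : p * (w * q) = q * (p * w) by rewrite mulnA mulnC.
move: (q * (p * w)) (q * q) (\sum_(u in _ | _) _) => x y z; lia.
Qed.

(** The factor 8 is relaxed to 192 to share the constant of the independent set. *)
Lemma col_gain_avg s d :
  #|F| * #|F| * col_pot s <=
  192 * \sum_(a : F) \sum_(b : F) \sum_v col_gain D G s d a b v.
Proof.
have -> : \sum_(a : F) \sum_(b : F) \sum_v col_gain D G s d a b v =
   \sum_v \sum_(a : F) \sum_(b : F) (colored D G s a b v : nat).
  under [LHS]eq_bigr do rewrite exchange_big /=.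
  by rewrite exchange_big.
rewrite col_potE !big_distrr /=; apply: leq_sum => v _.
case: (boolP (s v == 0)) => [sv|_]; last by rewrite muln0.
rewrite muln1; apply: leq_trans (colored_frequency sv) _.
by rewrite leq_mul2r orbT.
Qed.

End ColStep.

(** * Local completion of the coloring *)

Section ColFinish.
Variable n : nat.
Local Notation vec := {ffun 'I_n -> nat}.

(** Colored neighbours are listed too, since the completion must avoid their colors. *)
Definition col_lst (s : vec) (v : 'I_n) (N : {set 'I_n}) : seq nat :=
  if s v == 0 then map val (enum N) else [::].

(** Only edges with an uncolored end are tested; [col_inv] covers the rest. The type ['I_D.+2] holds
    the colors up to [D.+1], and 0 is excluded explicitly. *)
Definition col_rest (D : nat) (s : vec) (Ls : {ffun 'I_n -> seq nat})
    (f : {ffun 'I_n -> 'I_D.+2}) :=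
  [forall v, [&& 0 < f v, (s v != 0) ==> (f v == s v :> nat)
    & [forall u, (val u \in Ls v) ==> (f u != f v)]]].

Definition col_fin (D : nat) (s : vec) (Ls : {ffun 'I_n -> seq nat}) (v : 'I_n) : nat :=
  if [pick f | @col_rest D s Ls f] is Some f then nat_of_ord (f v) else 0.

Variables (G : graph n) (D : nat).
Hypothesis Gsym : forall u v, (u \in G v) = (v \in G u).
Hypothesis Girr : forall v, v \notin G v.
Hypothesis GD : forall v, #|G v| <= D.

Lemma mem_col_lst (s : vec) (u v : 'I_n) :
  (val u \in col_lst s v (G v)) = (s v == 0) && (u \in G v).
Proof.
rewrite /col_lst; case: ifP => //= _.
by rewrite mem_map ?mem_enum //; apply: val_inj.
Qed.

(** Greedy coloring: the palette of an uncolored node is never empty. *)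
Lemma col_extend (s : vec) : col_inv G D s ->
  exists t : vec, [/\ col_inv G D t, forall v, t v != 0 & forall v, s v != 0 -> t v = s v].
Proof.
move: {2}(col_pot s).+1 (ltnSn (col_pot s)) => m; elim: m s => // m IH s sm [leD prop].
case: (pickP (fun v => s v == 0)) => [v sv|none]; last first.
  by exists s; split=> // v; rewrite none.
have := palette_gt0 GD s v; case E: (palette D G s v) => [|c r] // _.
have : c \in palette D G s v by rewrite E mem_head.
rewrite mem_palette => /and3P[c0 cD /forall_inP cP].
pose s' : vec := [ffun u => if u == v then c else s u].
have [||t [It nz ext]] := IH s'.
- rewrite -ltnS; apply: leq_trans sm; rewrite ltnS; apply: proper_card.
  apply/properP; split.
    by apply/subsetP => u; rewrite !inE ffunE; case: (u == v) => //; rewrite eqn0Ngt c0.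
  by exists v; rewrite !inE ?ffunE ?eqxx // -lt0n.
- split=> [u|u w wu]; rewrite !ffunE; first by case: ifP.
  case: eqVneq => uv; case: eqVneq => wv.
  + by move: wu; rewrite uv wv (negbTE (Girr _)).
  + by move=> cw; have := cP w; rewrite -uv => /(_ wu); rewrite -cw eqxx.
  + by move=> cu; have := cP u; rewrite -wv Gsym => /(_ wu); rewrite cu eqxx.
  + exact: prop.
exists t; split=> // u su; rewrite ext ffunE; last by case: (u == v) => //; rewrite -lt0n.
by case: (eqVneq u v) su => // ->; rewrite sv.
Qed.

Lemma col_rest_exists s : col_inv G D s ->
  exists f, @col_rest D s [ffun u => col_lst s u (G u)] f.
Proof.
move=> /col_extend[t [[tD tprop] nz ext]].
pose f : {ffun 'I_n -> 'I_D.+2} := [ffun v => inord (t v)].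
have fE v : f v = t v :> nat by rewrite ffunE inordK // ltnS.
exists f; apply/forallP => v; rewrite fE lt0n nz /=; apply/andP; split.
  by apply/implyP => /ext ->.
apply/forallP => u; rewrite ffunE mem_col_lst; apply/implyP => /andP[_ uv].
rewrite -val_eqE /= !fE; apply/eqP => E.
by have := tprop v u uv (esym E); apply/eqP.
Qed.

Lemma col_finP s (f := col_fin D s [ffun u => col_lst s u (G u)]) : col_inv G D s ->
  (forall v, 1 <= f v <= D.+1) /\ (forall u v, v \in G u -> f u <> f v).
Proof.
move=> Is; rewrite /f /col_fin; case: pickP => [h /forallP hP|none]; last first.
  by have [h] := col_rest_exists Is; rewrite none.
split=> [v|u v vu E].
  by have /and3P[-> _ _] := hP v; rewrite /= -ltnS ltn_ord.
have /and3P[_ /implyP eu /forallP/(_ v) lu] := hP u.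
have /and3P[_ /implyP ev /forallP/(_ u) lv] := hP v.
move: lu lv; rewrite !ffunE !mem_col_lst (Gsym u v) vu !andbT.
case: (boolP (s u == 0)) => su /=; first by rewrite -val_eqE /= E eqxx.
case: (boolP (s v == 0)) => sv /=; first by rewrite -val_eqE /= E eqxx.
have [_ prop] := Is; move=> _ _; case/negP: (su); apply/eqP; apply: (prop u v vu).
by rewrite -(eqP (eu su)) -(eqP (ev sv)).
Qed.

End ColFinish.

Definition col_prog (K n : nat) : 'I_n -> {set 'I_n} -> prog n :=
  let F := seed_field n in
  solve K 191 (0%R : F) (@col_aux n)
    (fun D => @col_gain n F D) (fun D => @col_new n F D) (@col_lst n) (@col_fin n).

Lemma col_prog_runs K n (G : graph n) :
  (forall u v, (u \in G v) = (v \in G u)) -> (forall v, v \notin G v) ->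
  (\max_v #|G v|) ^ 3 <= K * n ->
  exists T, T <= (K + 1942) * (trunc_log 2 (\max_v #|G v|)).+1 /\
    Runs (2 ^ (5 * bits n)) T (fun v => col_prog K v (G v)) (fun f =>
      (forall v, 1 <= f v <= (\max_v #|G v|).+1) /\
      (forall u v, v \in G u -> f u <> f v)).
Proof.
move=> Gsym Girr DK; set D := \max_v _ in DK *.
have GD v : #|G v| <= D by exact: leq_bigmax.
have nF := ltn_card_seed_field n; have Fn := @card_seed_field_le n.
have HW := seed_message_bound n.
have [] := @Runs_solve n K 191 (seed_field n) 0%R (@col_aux n)
    (fun D => @col_gain n (seed_field n) D) (fun D => @col_new n (seed_field n) D)
    (@col_lst n) (@col_fin n) (2 ^ (5 * bits n)) G
    (fun f => (forall v, 1 <= f v <= D.+1) /\ (forall u v, v \in G u -> f u <> f v))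
    (col_inv G D) (@col_pot n) => //; last first.
- move=> T [TD R]; exists T; split=> //.
  by apply: leq_trans TD _; rewrite leq_mul2r; apply/orP; right; lia.
- by move=> s Is; apply: col_finP.
(* Each uncolored node publishes at most [D] entries, and [D * col_pot s] is at most the initial
   potential, itself at most [n]. *)
- move=> s _ D0 Dpot; apply: leq_trans (_ : D * col_pot s <= _); last first.
    by apply: leq_trans Dpot _; apply: card_set_le.
  rewrite col_potE big_distrr; apply: leq_sum => v _; rewrite /col_lst.
  by case: ifP => //= _; rewrite muln1 size_map -cardE.
- move=> s v x; rewrite /col_lst; case: ifP => // _ /mapP[u _ ->]; exact: ltn_ord.
- by move=> s v; rewrite /col_lst; case: ifP => // _; rewrite size_map -cardE.
- exact: col_inv0.
- move=> s Is D16 D2; apply: col_gain_avg => //; first exact: ltnW.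
  by rewrite -/D in D16 D2 *; nia.
- by move=> s a b Is; apply: col_pot_gain.
- by move=> s a b Is; apply: col_new_inv.
- move=> s a b v Is; have [leD _] := col_new_inv Gsym [ffun v => col_aux G s v] a b Is.
  apply: leq_trans (leD v) _; have D1 : D <= n by apply/bigmax_leqP => u _; apply: card_set_le.
  by have := ltn_ord v; lia.
- by move=> s d a b v; apply: leq_trans (leq_b1 _) _; have := ltn_ord v; lia.
- by move=> s d a b v; apply: col_new_view.
- by move=> s d a b v; rewrite /col_gain colored_view.
Qed.


(** * From ranks to identifiers *)

(** The state type of an [Alg] cannot depend on [n], so programs over ['I_n] are translated into
    this type, which addresses nodes by identifier. *)
Inductive node : Type :=
| Halt of nat
| Comm of (nat -> nat) & ((nat -> option nat) -> node).

Definition node_msg (p : node) (x : nat) := if p is Comm m _ then m x else 0.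
Definition node_upd (p : node) (rcv : nat -> option nat) :=
  if p is Comm _ k then k rcv else p.
Definition node_out (p : node) := if p is Halt o then Some o else None.

(* The network does not deliver a node's message to itself, whence [odflt]. *)
Fixpoint compile (ids : seq nat) n (me : 'I_n) (p : prog n) : node :=
  match p with
  | Ret o => Halt o
  | Exch s k =>
      Comm (fun x => if insub (index x ids) is Some j then s j else 0)
           (fun rcv => compile ids me
              (k [ffun j : 'I_n => odflt (s me) (rcv (nth 0 ids j))]))
  end.

(* The first round only reveals the set of identifiers; from then on nodes
   are addressed by rank. *)
Definition node_init (kid : nat) (P : forall n, 'I_n -> {set 'I_n} -> prog n)
    (n myid : nat) (nbr : nat -> bool) : node :=
  Comm (fun _ => 0) (fun rcv =>
    let ids := [seq x <- iota 0 (2 ^ (kid * bits n)) | (x == myid) || isSome (rcv x)] in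
    if insub (index myid ids) is Some me
    then compile ids me (P n me [set j : 'I_n | nbr (nth 0 ids j)])
    else Halt 0).

Definition node_alg kid P : Alg :=
  MkAlg (node_init kid P) node_msg node_upd node_out.

Section Simulation.
Variables (kid n : nat) (P : forall n, 'I_n -> {set 'I_n} -> prog n).
Variables (adj : rel 'I_n) (id : 'I_n -> nat).
Hypothesis id_inj : injective id.
Hypothesis id_lt : forall v, id v < 2 ^ (kid * bits n).

Local Notation A := (node_alg kid P).

Let ids := [seq x <- iota 0 (2 ^ (kid * bits n)) | x \in codom id].

Lemma id_ids v : id v \in ids.
Proof. by rewrite mem_filter codom_f mem_iota id_lt. Qed.

Lemma size_ids : size ids = n.
Proof.
have /perm_size -> : perm_eq ids (codom id).
  apply: uniq_perm.
  - by rewrite filter_uniq ?iota_uniq.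
  - by rewrite /codom /image_mem map_inj_uniq ?enum_uniq.
  - move=> x; rewrite mem_filter; case: (boolP (x \in codom id)) => //= /codomP[v ->].
    by rewrite mem_iota id_lt.
by rewrite size_codom card_ord.
Qed.

Lemma index_id_lt v : index (id v) ids < n.
Proof. by rewrite -[X in _ < X]size_ids index_mem id_ids. Qed.

(** The position in the increasing list of identifiers, on which all nodes agree after the first
    round. *)
Definition rank v : 'I_n := Ordinal (index_id_lt v).

Lemma nth_rank v : nth 0 ids (rank v) = id v.
Proof. by rewrite nth_index ?id_ids. Qed.

Lemma rank_inj : injective rank.
Proof. by move=> u v E; apply: id_inj; rewrite -!nth_rank E. Qed.

Definition vtx : 'I_n -> 'I_n := invF rank_inj.

Lemma vtxK j : rank (vtx j) = j. Proof. exact: f_invF. Qed.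
Lemma rankK v : vtx (rank v) = v. Proof. exact: invF_f. Qed.

Lemma nth_ids (j : 'I_n) : nth 0 ids j = id (vtx j).
Proof. by rewrite -nth_rank vtxK. Qed.

Lemma insub_index_id v : insub (index (id v) ids) = Some (rank v).
Proof. by rewrite (insubT (fun i => i < n) (index_id_lt v)). Qed.

Lemma pick_id v w :
  [pick u | (u != v) && (id u == id w)] = if w == v then None else Some w.
Proof.
case: pickP => [u /andP[uv /eqP/id_inj E]|none]; first by rewrite -E (negbTE uv).
by have := none w; rewrite eqxx andbT; case: eqP.
Qed.

Definition rank_graph : graph n := [ffun i => [set j | adj (vtx i) (vtx j)]].

Lemma run1 v : run A adj id 1 v = compile ids (rank v) (P (rank v) (rank_graph (rank v))).
Proof.
rewrite /=; set ids' := [seq x <- _ | _].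
have -> : ids' = ids.
  apply: eq_filter => x; case: pickP => [u /andP[_ /eqP <-]|none] /=.
    by rewrite orbT codom_f.
  rewrite orbF; apply/eqP/codomP => [->|[u xu]]; first by exists v.
  by have := none u; rewrite xu eqxx andbT => /negbFE/eqP ->.
rewrite insub_index_id; congr (compile _ _ (P _ _)); apply/setP => j.
rewrite inE ffunE inE rankK nth_ids /nbr_ids.
apply/existsP/idP => [[u /andP[vu /eqP/id_inj <-]] //|vj].
by exists (vtx j); rewrite vj eqxx.
Qed.

(** Each [Exch] is one network round, and the translated states match round by round, so message
    bounds and outputs carry over. *)
Lemma run_Runs W T t (R : 'I_n -> prog n) Q :
  (forall v, run A adj id t v = compile ids (rank v) (R (rank v))) ->
  Runs W T R Q ->
  (forall i (v u : 'I_n), i < T -> node_msg (run A adj id (t + i) v) (id u) < W) /\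
  exists f, (forall v, node_out (run A adj id (t + T) v) = Some (f (rank v))) /\ Q f.
Proof.
elim: T t R => [|T IH] t R E /=.
  by case=> f [Rf Qf]; split=> //; exists f; split=> // v; rewrite addn0 E Rf.
case=> s [k [Rk sW RT]].
have msgE v u : node_msg (run A adj id t v) (id u) = s (rank v) (rank u).
  by rewrite E Rk /= insub_index_id.
have [|mW [f [fT Qf]]] := IH t.+1 _ _ RT.
  move=> v; rewrite /= [in LHS]E Rk /=; congr (compile _ _ (k _ _)).
  apply/ffunP => j; rewrite !ffunE nth_ids pick_id.
  case: eqP => [jv|_] /=; first by rewrite -[in RHS](vtxK j) jv.
  by have := msgE (vtx j) v; rewrite /node_msg /= vtxK.
split; last by exists f; split=> // v; rewrite addnS -addSn fT.
move=> [|i] v u iT; first by rewrite addn0 msgE.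
by rewrite addnS -addSn mW.
Qed.

Lemma node_out_stable t v o : node_out (run A adj id t v) = Some o ->
  node_out (run A adj id t.+1 v) = Some o.
Proof. by move=> /=; case: (run _ _ _ _ _). Qed.

Lemma node_alg_computes B T Q (Q' : ('I_n -> nat) -> Prop) :
  Runs (2 ^ (B * bits n)) T (fun i => P i (rank_graph i)) Q ->
  (forall f, Q f -> Q' (fun v => f (rank v))) ->
  computes_within A adj id B T.+1 Q'.
Proof.
move=> RT QQ'; have [mW [f [fT Qf]]] := run_Runs run1 RT.
split; last split.
(* Round 0 only sends zeros. *)
- move=> [|t] v u tT _; first by rewrite expn_gt0.
  by have := mW t v u; rewrite add1n; apply.
- exact: node_out_stable.
- by exists (fun v => f (rank v)); split; [exact: fT | exact: QQ'].
Qed.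

Lemma max_degree_rank : max_degree adj = \max_i #|rank_graph i|.
Proof.
rewrite [RHS](reindex rank) /=; last by exists vtx => i _; [exact: rankK | exact: vtxK].
apply: eq_bigr => v _; rewrite ffunE rankK -(card_imset _ rank_inj).
congr #|pred_of_set _|; apply/setP => j; rewrite inE -{1}(vtxK j) mem_imset ?inE //.
exact: rank_inj.
Qed.

End Simulation.

Theorem theorem3 :
  forall K kid : nat,
    (exists (A : Alg) (C B : nat),
       forall n (adj : rel 'I_n) (id : 'I_n -> nat),
         simple_graph adj -> valid_ids id kid ->
         (max_degree adj) ^ 3 <= K * n ->
         exists T, T <= C * (trunc_log 2 (max_degree adj)).+1 /\
                   computes_within A adj id B T (is_MIS adj)) /\
    (exists (A : Alg) (C B : nat),
       forall n (adj : rel 'I_n) (id : 'I_n -> nat),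
         simple_graph adj -> valid_ids id kid ->
         (max_degree adj) ^ 3 <= K * n ->
         exists T, T <= C * (trunc_log 2 (max_degree adj)).+1 /\
                   computes_within A adj id B T (is_Delta1_coloring adj)).
Proof.
move=> K kid; split.
(* One round more than [K + 1942] pays for revealing the identifiers; the 5 comes from
   [seed_message_bound]. *)
- exists (node_alg kid (@mis_prog K)), (K + 1943), 5.
  move=> n adj id [adj_sym adj_irr] [id_inj id_lt].
  rewrite (max_degree_rank adj id_inj id_lt); set G := rank_graph _ _ _ => DK.
  have [u v|v|T [TD RT]] := @mis_prog_runs K n G _ _ DK.
  + by rewrite !ffunE !inE adj_sym.
  + by rewrite ffunE inE adj_irr.
  exists T.+1; split; first by nia.
  apply: (node_alg_computes (P := @mis_prog K) RT) => f [le1 indep dom]; split=> //.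
  split=> [u v uv|v fv0].
    by apply: indep; rewrite ffunE inE !rankK.
  have [j] := dom _ fv0; rewrite ffunE inE rankK => vj fj.
  by exists (vtx id_inj id_lt j); rewrite vtxK.
exists (node_alg kid (@col_prog K)), (K + 1943), 5.
move=> n adj id [adj_sym adj_irr] [id_inj id_lt].
have Emax := max_degree_rank adj id_inj id_lt.
rewrite Emax; set G := rank_graph _ _ _ in Emax * => DK.
have [u v|v|T [TD RT]] := @col_prog_runs K n G _ _ DK.
+ by rewrite !ffunE !inE adj_sym.
+ by rewrite ffunE inE adj_irr.
exists T.+1; split; first by nia.
apply: (node_alg_computes (P := @col_prog K) RT) => f [range proper]; split=> [v|u v uv].
  by rewrite Emax.
by apply: proper; rewrite ffunE inE !rankK.
Qed.
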